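(* There is a computationally efficient algorithm which, given $\varepsilon>0$, an integer $k$ with $2\le k\le n$, sample access to an unknown distribution $q$ over $[n]$, and an explicitly given distribution $p$ over $[n]$, draws $O(\sqrt{k}/\varepsilon^2)$ independent samples from $q$ and with probability at least $2/3$ distinguishes whether $q=p$ versus $\|q-p\|_{\mathcal{A}_k}\ge\varepsilon$ (i.e., outputs ``YES'' with probability at least $2/3$ if $q=p$ and ``NO'' with probability at least $2/3$ if $\|q-p\|_{\mathcal{A}_k}\ge\varepsilon$). Additionally, $\Omega(\sqrt{k}/\varepsilon^2)$ samples are information-theoretically necessary for any algorithm achieving this guarantee.
   Context: $[n]=\{1,\dots,n\}$ is viewed as an ordered set. For a distribution $p$ over $[n]$ and $S\subseteq[n]$, $p(S)=\sum_{i\in S}p_i$. Let $\mathfrak{J}_k$ denote the collection of all partitions of $[n]$ into $k$ intervals $I_1,\dots,I_k$. For distributions $p,q$ over $[n]$ and $2\le k\le n$, the $\mathcal{A}_k$-distance is $\|p-q\|_{\mathcal{A}_k}=\max_{(I_i)_{i=1}^k\in\mathfrak{J}_k}\sum_{i=1}^k|p(I_i)-q(I_i)|$.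
   Formalization: The lower bound of Ω(√k/ε²) samples is stated for 0 < ε ≤ 1 rather than all ε > 0; some constant upper bound on ε is needed, since the distance never exceeds 2 and for ε > 2 no samples are required. *)

(* Defs.v *)
From HB Require Import structures.
From mathcomp Require Import all_boot all_order all_algebra.
From mathcomp Require Import reals.
Set Implicit Arguments.
Unset Strict Implicit.
Unset Printing Implicit Defensive.
Import Order.TTheory GRing.Theory Num.Theory.
Local Open Scope ring_scope.

(* The domain [n] = {1, ..., n} is represented by 'I_n = {0, ..., n-1}. *)
Record dist (R : realType) (n : nat) := Dist {
  pmf :> {ffun 'I_n -> R};
  _ : [forall i, 0 <= pmf i] && (\sum_i pmf i == 1)
}.

HB.instance Definition _ (R : realType) (n : nat) := [isSub for @pmf R n].

Definition mass (R : realType) (n : nat) (p : dist R n) (S : {set 'I_n}) : R :=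
  \sum_(i in S) p i.

Definition is_interval (n : nat) (B : {set 'I_n}) : bool :=
  [forall i in B, forall l in B, forall j : 'I_n,
     (i <= j <= l)%N ==> (j \in B)].

(* A [partition] in the sense of finset has no empty block. *)
Definition interval_partition (n k : nat) (P : {set {set 'I_n}}) : bool :=
  [&& partition P [set: 'I_n], #|P| == k & [forall B in P, is_interval B]].

(* All the sums are nonnegative and an interval partition exists when
   1 <= k <= n, so the default value 0 does not affect the maximum. *)
Definition Ak_dist (R : realType) (n k : nat) (p q : dist R n) : R :=
  \big[Num.max/0]_(P : {set {set 'I_n}} | interval_partition k P)
     \sum_(B in P) `|mass p B - mass q B|.

Definition expect (R : realType) (n m : nat) (q : dist R n)
    (f : m.-tuple 'I_n -> R) : R :=
  \sum_(s : m.-tuple 'I_n) (\prod_(i < m) q (tnth s i)) * f s.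

(* A randomized decision rule based on m samples is represented by the
   conditional probability [yes s] of answering YES on the sample s; it
   answers NO with the remaining probability. *)
Definition tests_identity (R : realType) (n k : nat) (eps : R) (p : dist R n)
    (m : nat) (yes : m.-tuple 'I_n -> R) : Prop :=
  (forall s, 0 <= yes s <= 1) /\
  forall q : dist R n,
    (q = p -> 2 / 3 <= expect q yes) /\
    (eps <= Ak_dist k q p -> 2 / 3 <= expect q (fun s => 1 - yes s)).

(* Model of computation: a real RAM with oracle access to samples and to fair
   coins.  The memory consists of arrays of natural numbers and of arrays of
   reals, named by numerals that are fixed in the program, and indexed by
   computed naturals.  Unit-cost arithmetic is limited to +, - on naturals
   (which keeps their bit size linear in the running time) and to the field
   operations on reals; the only real literals are naturals, and reals
   influence naturals only through comparisons (there is no floor). *)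
Inductive nexp :=
  | NLit of nat
  | NGet of nat & nexp
  | NAdd of nexp & nexp
  | NSub of nexp & nexp.

Inductive rexp :=
  | RNat of nexp
  | RGet of nat & nexp
  | RAdd of rexp & rexp
  | RSub of rexp & rexp
  | RMul of rexp & rexp
  | RDiv of rexp & rexp.

Inductive bexp :=
  | BNle of nexp & nexp
  | BRle of rexp & rexp
  | BNot of bexp
  | BAnd of bexp & bexp.

Inductive cmd :=
  | Skip
  | NSet of nat & nexp & nexp
  | RSet of nat & nexp & rexp
  | Draw of nat & nexp
  | Flip of nat & nexp
  | Seq of cmd & cmd
  | If of bexp & cmd & cmd
  | While of bexp & cmd.

Record state (R : realType) := State {
  nmem : nat -> nat -> nat;
  rmem : nat -> nat -> R;
  drawn : nat;
  flipped : nat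
}.

Definition upd (V : Type) (mem : nat -> nat -> V) (a i : nat) (v : V) :=
  fun b j => if (b == a) && (j == i) then v else mem b j.

Fixpoint neval (R : realType) (st : state R) (e : nexp) : nat :=
  match e with
  | NLit c => c
  | NGet a i => nmem st a (neval st i)
  | NAdd e1 e2 => (neval st e1 + neval st e2)%N
  | NSub e1 e2 => (neval st e1 - neval st e2)%N
  end.

Fixpoint reval (R : realType) (st : state R) (e : rexp) : R :=
  match e with
  | RNat i => (neval st i)%:R
  | RGet a i => rmem st a (neval st i)
  | RAdd e1 e2 => reval st e1 + reval st e2
  | RSub e1 e2 => reval st e1 - reval st e2
  | RMul e1 e2 => reval st e1 * reval st e2
  | RDiv e1 e2 => reval st e1 / reval st e2
  end.

Fixpoint beval (R : realType) (st : state R) (b : bexp) : bool :=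
  match b with
  | BNle e1 e2 => (neval st e1 <= neval st e2)%N
  | BRle e1 e2 => reval st e1 <= reval st e2
  | BNot b1 => ~~ beval st b1
  | BAnd b1 b2 => beval st b1 && beval st b2
  end.

(* A configuration is the stack of commands still to be executed and the
   current memory; the machine has halted when the stack is empty.  Expressions
   have constant size in a fixed program, so each step has constant cost.  The
   j-th Draw (resp. Flip) returns [sample j] (resp. [coin j]). *)
Definition step (R : realType) (sample : nat -> nat) (coin : nat -> bool)
    (cfg : seq cmd * state R) : seq cmd * state R :=
  let: (stack, st) := cfg in
  if stack is c :: rest then
    let: State nm rm dr fl := st in
    match c with
    | Skip => (rest, st)
    | NSet a i e =>
        (rest, State (upd nm a (neval st i) (neval st e)) rm dr fl)
    | RSet a i e =>
        (rest, State nm (upd rm a (neval st i) (reval st e)) dr fl)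
    | Draw a i =>
        (rest, State (upd nm a (neval st i) (sample dr)) rm dr.+1 fl)
    | Flip a i =>
        (rest, State (upd nm a (neval st i) (nat_of_bool (coin fl))) rm dr fl.+1)
    | Seq c1 c2 => (c1 :: c2 :: rest, st)
    | If b c1 c2 => ((if beval st b then c1 else c2) :: rest, st)
    | While b c1 => (if beval st b then c1 :: c :: rest else rest, st)
    end
  else cfg.

(* Inputs: n and k in cells 0 and 1 of natural array 0, eps in cell 0 of real
   array 0, and p in the first n cells of real array 1; all other cells are 0. *)
Definition init_state (R : realType) (n k : nat) (eps : R) (p : dist R n) :
    state R :=
  State (fun a i => if (a, i) == (0, 0)%N then n
                    else if (a, i) == (0, 1)%N then k else 0%N)
        (fun a i => if (a, i) == (0, 0)%N then eps
                    else if a == 1%N then oapp p 0 (insub i) else 0)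
        0 0.

Definition run (R : realType) (prog : cmd) (n k : nat) (eps : R) (p : dist R n)
    (m T : nat) (s : m.-tuple 'I_n) (r : T.-tuple bool) : seq cmd * state R :=
  iter T (step (nth 0%N (map val s)) (nth false r))
       ([:: prog], init_state k eps p).

(* On every outcome of the samples and of the coins the program halts within T
   steps and draws at most m samples.  As a step flips at most one coin, such a
   run never reads past the ends of s and r. *)
Definition runs_within (R : realType) (prog : cmd) (n k : nat) (eps : R)
    (p : dist R n) (m T : nat) : Prop :=
  forall (s : m.-tuple 'I_n) (r : T.-tuple bool),
    nilp (run prog k eps p s r).1 /\ (drawn (run prog k eps p s r).2 <= m)%N.

(* The output is read in cell 0 of natural array 1: nonzero means YES. *)
Definition says_yes (R : realType) (cfg : seq cmd * state R) : bool :=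
  nmem cfg.2 1 0 != 0%N.

Definition prog_yes (R : realType) (prog : cmd) (n k : nat) (eps : R)
    (p : dist R n) (m T : nat) (s : m.-tuple 'I_n) : R :=
  #|[set r : T.-tuple bool | says_yes (run prog k eps p s r)]|%:R / 2 ^+ T.

(* Main.v *)
(* Upper bound.  The quantile transform of p turns p into the uniform
   distribution on [0, 1]; a sample x then stands for a uniform point of an
   interval of length p x.  At scale j, cut [0, 1] into k 2^j equal cells and let
   D_j be the vector of differences of cell masses of q and p.  The tester
   estimates S = sum_j (5/4)^j |D_j|^2 without bias by a bilinear statistic of
   two independent batches of M samples, the random position of a point inside
   its interval being averaged out.  If the A_k-distance is at least eps, the
   union N of the blocks on which q < p has p(N) - q(N) >= eps/2; up to at most k
   boundary cells it is a union of cells of the finest scale, which regroups into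
   O(k) maximal cells at each scale, so Cauchy-Schwarz gives S >= eps^2/(160 k).
   Chebyshev's inequality concludes, because the standard deviation of the
   statistic is O(1/(M sqrt k)) when q = p, and at most a small multiple of S
   otherwise.

   Lower bound.  Take p uniform on 2h points, h = k/2 rounded down, and tilt each
   of the h pairs by a random sign times eps.  The second moment of the averaged
   likelihood ratio of m samples is at most exp(2 m^2 eps^4 / h). *)
Require Import Defs.
From mathcomp Require Import all_boot all_order all_algebra.
From mathcomp Require Import reals sequences exp.
From mathcomp Require Import zify ring lra.
Set Implicit Arguments.
Unset Strict Implicit.
Unset Printing Implicit Defensive.
Import Order.TTheory GRing.Theory Num.Theory.
Local Open Scope ring_scope.

(** * Expectations over independent samples *)

(** Why several scales: the blocks are unknown, and resolving their ends takes about l = k / eps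
    cells. At that single resolution Cauchy-Schwarz guarantees only a signal eps^2 / l against noise
    1 / (M sqrt l), which asks for M of order sqrt l / eps^2, too many by a factor eps^(-1/2). What
    rescues the rate is that only O(k) cells of each scale matter, however fine the scale, so each
    scale is judged by k and not by its number of cells.

    Averaging out the position inside an interval makes the tester deterministic: it flips no coin,
    and its answer is a function of the samples. Using two batches rather than the pairs of one
    batch removes diagonal terms, and it makes the statistic a product of two sums in each cell, so
    a cell costs O(M) operations and not M^2. *)

Lemma jensen_sqr (R : realFieldType) (I : finType) (a y : I -> R) :
  (forall i, 0 <= a i) ->
  (\sum_i a i * y i) ^+ 2 <= (\sum_i a i) * \sum_i a i * y i ^+ 2.
Proof.
move=> a0; set A := \sum_i a i; set B := \sum_i a i * y i.
have A0 : 0 <= A by apply: sumr_ge0.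
have [Az|Anz] := eqVneq A 0.
  have az i : a i = 0 by apply/eqP; have /eqP := Az; rewrite psumr_eq0 // => /allP/(_ i (mem_index_enum i)).
  by rewrite /B big1 ?expr0n ?Az ?mul0r // => i _; rewrite az mul0r.
have Ap : 0 < A by rewrite lt_def Anz.
(* This is A times the variance of y under the weights a / A. *)
have : 0 <= \sum_i a i * (y i - B / A) ^+ 2.
  by apply: sumr_ge0 => i _; rewrite mulr_ge0 // sqr_ge0.
have -> : \sum_i a i * (y i - B / A) ^+ 2
    = \sum_i a i * y i ^+ 2 - 2 * (B / A) * B + (B / A) ^+ 2 * A.
  rewrite [_ * B]mulr_sumr [_ * A]mulr_sumr -sumrB -big_split /=.
  by apply: eq_bigr => i _; ring.
have -> : \sum_i a i * y i ^+ 2 - 2 * (B / A) * B + (B / A) ^+ 2 * A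
   = (A * (\sum_i a i * y i ^+ 2) - B ^+ 2) / A by field.
by rewrite pmulr_lge0 ?invr_gt0 // subr_ge0.
Qed.

Section IidSamples.
Variables (R : realType) (n : nat) (q : dist R n).

(** Lists instead of tuples, so that induction on m and splitting a sample into batches involve no
    dependent lengths; [Esamp_tuple] ties this to [expect]. *)
Fixpoint Esamp (m : nat) (f : seq 'I_n -> R) : R :=
  if m is m'.+1 then \sum_x q x * Esamp m' (fun s => f (x :: s)) else f [::].

Lemma pmf_ge0 x : 0 <= q x.
Proof. by case: q => f /= /andP[/forallP]. Qed.

Lemma pmf_sum : \sum_x q x = 1.
Proof. by case: q => f /= /andP[_ /eqP]. Qed.

Lemma eq_Esamp m f g : (forall s, size s = m -> f s = g s) -> Esamp m f = Esamp m g.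
Proof.
elim: m f g => [|m IH] f g fg /=; first exact: fg.
by apply: eq_bigr => x _; congr (_ * _); apply: IH => s sm; apply: fg; rewrite /= sm.
Qed.

Lemma ler_Esamp m f g : (forall s, size s = m -> f s <= g s) -> Esamp m f <= Esamp m g.
Proof.
elim: m f g => [|m IH] f g fg /=; first exact: fg.
apply: ler_sum => x _; apply: ler_wpM2l; first exact: pmf_ge0.
by apply: IH => s sm; apply: fg; rewrite /= sm.
Qed.

Lemma EsampD m f g : Esamp m (fun s => f s + g s) = Esamp m f + Esamp m g.
Proof.
elim: m f g => [|m IH] f g //=.
by rewrite -big_split /=; apply: eq_bigr => x _; rewrite IH mulrDr.
Qed.

Lemma EsampZ m c f : Esamp m (fun s => c * f s) = c * Esamp m f.
Proof.
elim: m f => [|m IH] f //=.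
by rewrite mulr_sumr; apply: eq_bigr => x _; rewrite IH mulrCA.
Qed.

Lemma Esamp_cst m c : Esamp m (fun=> c) = c.
Proof.
elim: m => [|m IH] //=.
by under eq_bigr do rewrite IH; rewrite -mulr_suml pmf_sum mul1r.
Qed.

Lemma Esamp_sum m (I : finType) (F : I -> seq 'I_n -> R) :
  Esamp m (fun s => \sum_i F i s) = \sum_i Esamp m (F i).
Proof.
elim: m F => [|m IH] F //=.
rewrite exchange_big /=; apply: eq_bigr => x _.
by rewrite IH mulr_sumr.
Qed.

Lemma Esamp_cat m1 m2 f :
  Esamp (m1 + m2) f = Esamp m1 (fun s1 => Esamp m2 (fun s2 => f (s1 ++ s2))).
Proof. by elim: m1 f => [|m IH] f //=; apply: eq_bigr => x _; rewrite IH. Qed.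

Lemma Esamp_prod m (g : 'I_n -> R) :
  Esamp m (fun s => \prod_(x <- s) g x) = (\sum_x q x * g x) ^+ m.
Proof.
elim: m => [|m IH] /=; first by rewrite big_nil expr0.
rewrite exprS -IH mulr_suml; apply: eq_bigr => x _.
under eq_Esamp do rewrite big_cons.
by rewrite EsampZ mulrA.
Qed.

Lemma Esamp_sum_iid m (g : 'I_n -> R) :
  Esamp m (fun s => \sum_(x <- s) g x) = m%:R * \sum_x q x * g x.
Proof.
elim: m => [|m IH] /=; first by rewrite big_nil mul0r.
under eq_bigr => x _.
  under eq_Esamp do rewrite big_cons.
  rewrite EsampD Esamp_cst IH mulrDr; over.
by rewrite big_split /= -mulr_suml pmf_sum mul1r -natr1 mulrDl mul1r addrC.
Qed.

(** The square has m diagonal terms and m (m - 1) products of independent factors. *)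
Lemma Esamp_sqr_sum_iid m (g : 'I_n -> R) :
  Esamp m (fun s => (\sum_(x <- s) g x) ^+ 2) =
  m%:R * \sum_x q x * g x ^+ 2 + m%:R * (m%:R - 1) * (\sum_x q x * g x) ^+ 2.
Proof.
elim: m => [|m IH] /=; first by rewrite big_nil expr0n /= !mul0r addr0.
set e1 := \sum_x q x * g x in IH *; set e2 := \sum_x q x * g x ^+ 2 in IH *.
under eq_bigr => x _.
  under eq_Esamp do rewrite big_cons sqrrD -mulr_natl mulrA -addrA.
  rewrite EsampD Esamp_cst EsampD EsampZ IH Esamp_sum_iid -/e1.
  rewrite mulrDr mulrDr.
  have -> : q x * (2%:R * g x * (m%:R * e1)) = (2%:R * m%:R * e1) * (q x * g x) by ring.
  over.
rewrite !big_split /= -mulr_suml pmf_sum -mulr_sumr -/e1 -/e2 -natr1.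
by ring.
Qed.

Lemma Esamp_tuple m (f : seq 'I_n -> R) :
  \sum_(s : m.-tuple 'I_n) (\prod_(i < m) q (tnth s i)) * f s = Esamp m f.
Proof.
elim: m f => [|m IH] f /=.
  rewrite (big_pred1 [tuple]) => [|s]; last by rewrite /= [s]tuple0; exact/esym/eqP.
  by rewrite big_ord0 mul1r.
rewrite (reindex (fun xs : 'I_n * m.-tuple 'I_n => [tuple of xs.1 :: xs.2])) /=; last first.
  exists (fun s => (thead s, [tuple of behead s])) => [[x s]|s] _ /=.
    by rewrite theadE; congr pair; apply: val_inj.
  by rewrite [s in RHS]tuple_eta.
rewrite -(pair_bigA _ (fun x (s : m.-tuple _) =>
   (\prod_(i < m.+1) q (tnth [tuple of x :: s] i)) * f (x :: s))) /=.
apply: eq_bigr => x _.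
rewrite -IH mulr_sumr; apply: eq_bigr => s _.
by rewrite big_ord_recl tnth0 mulrA; congr (_ * _ * _); apply: eq_bigr => i _; rewrite tnthS.
Qed.

End IidSamples.

(** * Splitting [0, 1] into equal cells along the distribution function of p *)

Lemma sum_double (V : nmodType) (l : nat) (F : nat -> V) :
  \sum_(c < l.*2) F c = \sum_(c < l) (F c.*2 + F c.*2.+1).
Proof.
elim: l => [|l IH]; first by rewrite !big_ord0.
by rewrite doubleS !big_ord_recr /= IH addrA.
Qed.

Section Cells.
Variables (R : realType) (n : nat) (p : dist R n).

Definition cdf (i : nat) : R := \sum_(x < n | (x < i)%N) p x.

(* The fraction of the interval of x that lies below t / l.  When p x = 0 the
   division yields 0, so such points belong to no cell at all. *)
Definition ucell (l t : nat) (x : 'I_n) : R :=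
  (Num.min (cdf x.+1) (t%:R / l%:R) - Num.min (cdf x) (t%:R / l%:R)) / p x.

Definition cell (l c : nat) (x : 'I_n) : R := ucell l c.+1 x - ucell l c x.

Lemma cdf0 : cdf 0 = 0.
Proof. by rewrite /cdf big_pred0. Qed.

Lemma cdfn : cdf n = 1.
Proof. by rewrite /cdf -(pmf_sum p); apply: eq_bigl => x; rewrite ltn_ord. Qed.

Lemma cdfS (x : 'I_n) : cdf x.+1 = cdf x + p x.
Proof.
rewrite /cdf (bigD1 x) //= addrC; congr (_ + _).
by apply: eq_bigl => y; rewrite ltnS ltn_neqAle andbC.
Qed.

Lemma cdf_le i j : (i <= j)%N -> cdf i <= cdf j.
Proof.
move=> ij; rewrite /cdf big_mkcond [leRHS]big_mkcond /=.
apply: ler_sum => x _; case: ltnP => [xi|_]; first by rewrite (leq_trans xi ij).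
by case: ifP => _ //; apply: pmf_ge0.
Qed.

(** Each difference is the length of the part of [a, b] below s, respectively t. *)
Lemma min_diff_mono (a b s t : R) : a <= b -> s <= t ->
  Num.min b s - Num.min a s <= Num.min b t - Num.min a t.
Proof. by rewrite !minEle; case: (lerP b s); case: (lerP a s); case: (lerP b t); case: (lerP a t); lra. Qed.

Lemma cell_ge0 l c x : 0 <= cell l c x.
Proof.
rewrite /cell /ucell -mulrBl mulr_ge0 ?invr_ge0 ?pmf_ge0 // subr_ge0.
apply: min_diff_mono; first exact: cdf_le.
by rewrite ler_wpM2r ?invr_ge0 ?ler0n // ler_nat.
Qed.

Lemma ucell_double l t x : ucell l.*2 t.*2 x = ucell l t x.
Proof.
rewrite /ucell -!mul2n !natrM.
have [->|lz] := eqVneq l 0%N; first by rewrite mulr0 !invr0 !mulr0.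
by rewrite -mulf_div divff ?mul1r // pnatr_eq0.
Qed.

Lemma cell_double l c x : cell l c x = cell l.*2 c.*2 x + cell l.*2 c.*2.+1 x.
Proof. by rewrite /cell -doubleS !ucell_double; ring. Qed.

(** Also valid when p x = 0: the interval of x is then a point and both sides vanish. *)
Lemma pmf_ucell l t x : p x * ucell l t x =
  Num.min (cdf x.+1) (t%:R / l%:R) - Num.min (cdf x) (t%:R / l%:R).
Proof.
rewrite /ucell; have [px0|pxn] := eqVneq (p x) 0; last by rewrite mulrCA divff ?mulr1.
by rewrite cdfS px0 addr0 subrr !mul0r.
Qed.

Lemma sum_cell l x : \sum_(c < l) cell l c x = ucell l l x - ucell l 0 x.
Proof.
rewrite -(telescope_sumr (fun c => ucell l c x)) // big_mkord.
by apply: eq_bigr => c _.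
Qed.

Lemma cdf_ge0 i : 0 <= cdf i.
Proof. by rewrite -cdf0 cdf_le. Qed.

Lemma cdf_le1 i : (i <= n)%N -> cdf i <= 1.
Proof. by move=> ?; rewrite -cdfn cdf_le. Qed.

(** The factor p x matters: a point of p-mass zero lies in no cell, so its fractions sum to 0 and
    not to 1. *)
Lemma pmf_sum_cell l x : (0 < l)%N -> p x * \sum_(c < l) cell l c x = p x.
Proof.
move=> l0; rewrite sum_cell mulrBr !pmf_ucell mul0r divff ?pnatr_eq0 -?lt0n //.
rewrite [Num.min (cdf x.+1) 1]min_l ?[Num.min (cdf x) 1]min_l ?cdf_le1 ?(ltnW (ltn_ord x)) //.
by rewrite !min_r ?cdf_ge0 // cdfS; ring.
Qed.

Lemma sum_cell_le1 l x : (0 < l)%N -> \sum_(c < l) cell l c x <= 1.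
Proof.
move=> l0; have := pmf_sum_cell x l0.
have [px0 _|pxn] := eqVneq (p x) 0.
  by rewrite sum_cell /ucell px0 invr0 !mulr0 subr0.
by move/(canRL (mulKf pxn)) ->; rewrite mulVf.
Qed.

(** This is the uniformity produced by the quantile transform; the sum over x telescopes. *)
Lemma sum_pmf_cell l c : (c < l)%N -> \sum_x p x * cell l c x = l%:R^-1.
Proof.
move=> cl; have l0 : 0 < l%:R :> R by rewrite ltr0n (leq_ltn_trans _ cl).
have tot t : (t <= l)%N -> \sum_x p x * ucell l t x = t%:R / l%:R.
  move=> tl; under eq_bigr do rewrite pmf_ucell.
  rewrite -(big_mkord xpredT (fun x => Num.min (cdf x.+1) (t%:R / l%:R) - Num.min (cdf x) (t%:R / l%:R))).
  rewrite (telescope_sumr (fun x => Num.min (cdf x) (t%:R / l%:R))) //.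
  have tl1 : t%:R / l%:R <= 1 :> R by rewrite ler_pdivrMr // mul1r ler_nat.
  by rewrite cdf0 cdfn min_r // min_l ?subr0 // divr_ge0 ?ler0n.
under eq_bigr do rewrite /cell mulrBr.
by rewrite sumrB !tot //; [rewrite -natr1; field; rewrite gt_eqF | apply: ltnW].
Qed.

(** Strictness keeps a block end that lies on the border of two cells from being charged to either
    of them. *)
Lemma cell_neq0 l c x : cell l c x != 0 ->
  cdf x < c.+1%:R / l%:R /\ c%:R / l%:R < cdf x.+1.
Proof.
rewrite /cell /ucell -mulrBl mulf_eq0 negb_or => /andP[+ _].
have ab : cdf x <= cdf x.+1 by apply: cdf_le.
have st : c%:R / l%:R <= c.+1%:R / l%:R :> R.
  by rewrite ler_wpM2r ?invr_ge0 ?ler0n // ler_nat.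
move: (cdf x) (cdf x.+1) ab (c%:R / _) (c.+1%:R / _) st => a b ab s t st.
rewrite !minEle => /eqP h.
by split; move: h; case: (lerP b s); case: (lerP a s); case: (lerP b t); case: (lerP a t); lra.
Qed.

End Cells.

(** * The multiscale signal and its lower bound *)

Section Signal.
Variables (R : realType) (n : nat) (p q : dist R n).

Definition dev (l c : nat) : R := \sum_x (q x - p x) * cell p l c x.

Definition dev2 (l : nat) : R := \sum_(c < l) dev l c ^+ 2.

(* The ratio must lie strictly between 1 and sqrt 2: the signal bound needs the
   sum of 1 / w_j, and the variance bound that of w_j / sqrt (2 ^ j). *)
Definition weight (j : nat) : R := (5 / 4) ^+ j.

Definition signal (k J : nat) : R :=
  \sum_(j < J) weight j * dev2 (k * 2 ^ j).

Lemma dev_double l c : dev l c = dev l.*2 c.*2 + dev l.*2 c.*2.+1.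
Proof. by rewrite -big_split; apply: eq_bigr => x _; rewrite cell_double mulrDr. Qed.

Lemma dev2_ge0 l : 0 <= dev2 l.
Proof. by apply: sumr_ge0 => c _; apply: sqr_ge0. Qed.

Lemma weight_gt0 j : 0 < weight j.
Proof. by rewrite exprn_gt0 // divr_gt0. Qed.

Lemma signal_ge0 k J : 0 <= signal k J.
Proof.
by apply: sumr_ge0 => j _; rewrite mulr_ge0 ?dev2_ge0 // ltW ?weight_gt0.
Qed.

Section Region.
Variable N : {set 'I_n}.

Definition full (l c : nat) : bool :=
  [forall i, (i \notin N) ==> (cell p l c i == 0)].

Definition mixed (l c : nat) : bool :=
  ~~ full l c && [exists i in N, cell p l c i != 0].

Lemma full_double l c : full l c = full l.*2 c.*2 && full l.*2 c.*2.+1.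
Proof.
apply/forallP/andP => [H|[/forallP H1 /forallP H2] i].
  split; apply/forallP => i; apply/implyP => iN; move: (H i); rewrite iN /=;
  by rewrite cell_double paddr_eq0 ?cell_ge0 // => /andP[].
by apply/implyP => iN; rewrite cell_double (eqP (implyP (H1 i) iN)) (eqP (implyP (H2 i) iN)) addr0.
Qed.

(** Otherwise no point at all would meet the cell, whose p-mass is 1 / l. *)
Lemma full_touched l c : (c < l)%N -> full l c -> [exists i in N, cell p l c i != 0].
Proof.
move=> cl /forallP F; apply: contraT => /existsPn H.
have := sum_pmf_cell p cl; rewrite big1 => [/eqP|i _].
  by rewrite eq_sym invr_eq0 pnatr_eq0 -leqn0 leqNgt (leq_ltn_trans _ cl).
have /eqP -> : cell p l c i == 0; last by rewrite mulr0.
have [iN|iN] := boolP (i \in N); last by have := F i; rewrite iN.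
by have := H i; rewrite iN negbK.
Qed.

(** Halves of a full cell are full. A full half of a cell that is not full touches N, which makes
    its parent mixed. So cells that become full at the finer scale arise only inside mixed cells. *)
Lemma half_mixed l c d : (c < l)%N -> d \in [:: c.*2; c.*2.+1] ->
  `|(full l.*2 d)%:R - (full l c)%:R| <= (mixed l c)%:R :> R.
Proof.
move=> cl dc.
have fd : full l c -> full l.*2 d.
  by rewrite full_double => /andP[f1 f2]; move: dc; rewrite !inE => /orP[] /eqP ->.
rewrite /mixed; have [F|F] := boolP (full l c); first by rewrite fd // subrr normr0.
have [Fd|_] /= := boolP (full l.*2 d); last by rewrite subrr normr0.
have dl : (d < l.*2)%N by move: dc; rewrite !inE => /orP[] /eqP ->; lia.
suff -> : [exists i in N, cell p l c i != 0] by rewrite subr0 normr1.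
have /existsP[i /andP[iN ti]] := full_touched dl Fd.
apply/existsP; exists i; rewrite iN /=; apply: contraNneq ti.
move/eqP; rewrite cell_double paddr_eq0 ?cell_ge0 // => /andP[].
by move: dc; rewrite !inE => /orP[] /eqP ->.
Qed.

(** The part of q(N) - p(N) visible at scale l, with N replaced by the cells that it fills. *)
Definition fulldev (l : nat) : R := \sum_(c < l) (full l c)%:R * dev l c.

(** The increment only collects full halves of mixed cells, so Cauchy-Schwarz is paid for by the
    number of mixed cells and not by l; the factor 2 accounts for the two halves. *)
Lemma fulldev_double_le l :
  (fulldev l.*2 - fulldev l) ^+ 2 <= (\sum_(c < l) (mixed l c)%:R) * (2 * dev2 l.*2).
Proof.
pose y c := `|dev l.*2 c.*2| + `|dev l.*2 c.*2.+1|.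
have le1 : `|fulldev l.*2 - fulldev l| <= \sum_(c < l) (mixed l c)%:R * y c.
  rewrite /fulldev (sum_double l (fun c => (full l.*2 c)%:R * dev l.*2 c)) -sumrB.
  apply: le_trans (ler_norm_sum _ _ _) _; apply: ler_sum => c _.
  have -> : (full l.*2 c.*2)%:R * dev l.*2 c.*2 + (full l.*2 c.*2.+1)%:R * dev l.*2 c.*2.+1
      - (full l c)%:R * dev l c
    = ((full l.*2 c.*2)%:R - (full l c)%:R) * dev l.*2 c.*2
      + ((full l.*2 c.*2.+1)%:R - (full l c)%:R) * dev l.*2 c.*2.+1.
    by rewrite (dev_double l c); ring.
  apply: le_trans (ler_normD _ _) _; rewrite !normrM mulrDr.
  by apply: lerD; apply: ler_wpM2r => //; apply: half_mixed; rewrite ?inE ?eqxx ?orbT.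
have y0 : 0 <= \sum_(c < l) (mixed l c)%:R * y c.
  by apply: sumr_ge0 => c _; rewrite mulr_ge0 ?ler0n ?addr_ge0.
rewrite -real_normK ?num_real //.
apply: le_trans (_ : (\sum_(c < l) (mixed l c)%:R * y c) ^+ 2 <= _).
  by rewrite ler_sqr ?nnegrE.
apply: le_trans (jensen_sqr (fun c : 'I_l => y c) (fun c : 'I_l => ler0n R (mixed l c))) _.
apply: ler_wpM2l; first by apply: sumr_ge0 => c _; rewrite ler0n.
rewrite /dev2 (sum_double l (fun c => dev l.*2 c ^+ 2)) mulr_sumr.
apply: ler_sum => c _.
have m1 : (mixed l c)%:R <= 1 :> R by case: mixed.
have := sqr_ge0 (`|dev l.*2 c.*2| - `|dev l.*2 c.*2.+1|).
rewrite -[dev _ _ ^+ 2]real_normK ?num_real // -[dev _ c.*2.+1 ^+ 2]real_normK ?num_real //.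
move=> h; apply: le_trans (ler_wpM2r (sqr_ge0 _) m1) _.
by rewrite mul1r /y; lra.
Qed.

(** Serves the coarsest scale l = k, where counting all cells is affordable. *)
Lemma fulldev_le l : fulldev l ^+ 2 <= l%:R * dev2 l.
Proof.
apply: le_trans (jensen_sqr (fun c : 'I_l => dev l c) (fun c : 'I_l => ler0n R (full l c))) _.
apply: ler_pM.
- by apply: sumr_ge0 => c _; rewrite ler0n.
- by apply: sumr_ge0 => c _; rewrite mulr_ge0 ?ler0n ?sqr_ge0.
- have -> : l%:R = \sum_(c < l) 1 :> R by rewrite sumr_const card_ord.
  apply: ler_sum => c _.
  by rewrite lern1 leq_b1.
- by apply: ler_sum => c _; rewrite ler_piMl ?sqr_ge0 // lern1 leq_b1.
Qed.

(** The bound is one-sided: the q-mass of N outside full cells, including that on points where p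
    vanishes, is dropped with the favourable sign. Hence only p-mass is lost, and it sits in mixed
    cells of mass 1 / l each. *)
Lemma region_mass_le l : (0 < l)%N ->
  \sum_(i in N) (p i - q i) <= - fulldev l + (\sum_(c < l) (mixed l c)%:R) / l%:R.
Proof.
move=> l0.
have fE : - fulldev l =
    \sum_(i in N) (p i - q i) * \sum_(c < l) (full l c)%:R * cell p l c i.
  under eq_bigr do rewrite mulr_sumr.
  rewrite exchange_big /fulldev -sumrN /=; apply: eq_bigr => c _.
  rewrite /dev mulr_sumr -sumrN big_mkcond [RHS]big_mkcond /=.
  apply: eq_bigr => i _; case: ifP => iN; first by ring.
  have [/forallP /(_ i)|] := boolP (full l c); last by rewrite mul0r oppr0.
  by rewrite iN /= => /eqP ->; rewrite !mulr0 oppr0.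
have mE : \sum_(i in N) p i * (\sum_(c < l) (~~ full l c)%:R * cell p l c i)
    <= (\sum_(c < l) (mixed l c)%:R) / l%:R.
  under eq_bigr do rewrite mulr_sumr.
  rewrite exchange_big mulr_suml /=; apply: ler_sum => c _.
  rewrite /mixed; case: full => /=.
    by rewrite mul0r big1 // => i _; rewrite mul0r mulr0.
  have [/existsP|/existsPn H] := boolP [exists i in N, cell p l c i != 0].
    move=> _; rewrite mul1r -(sum_pmf_cell p (ltn_ord c)) big_mkcond /=.
    apply: ler_sum => i _; case: ifP => _; first by rewrite mul1r.
    by rewrite mulr_ge0 ?pmf_ge0 ?cell_ge0.
  rewrite mul0r big1 // => i iN.
  by have := H i; rewrite iN negbK => /eqP ->; rewrite !mulr0.
apply: le_trans (lerD (lexx _) mE); rewrite fE -big_split /=.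
apply: ler_sum => i iN.
set s1 := \sum_(c < l) (full l c)%:R * cell p l c i.
set s2 := \sum_(c < l) _.
have s12 : s1 + s2 = \sum_(c < l) cell p l c i.
  by rewrite -big_split; apply: eq_bigr => c _ /=; case: full; rewrite !(mul0r, mul1r, addr0, add0r).
have ps : p i * s2 = p i * (1 - s1).
  by rewrite mulrBr mulr1 -[X in _ = X - _](pmf_sum_cell p i l0) -s12; ring.
have s1le : s1 <= 1.
  apply: le_trans (sum_cell_le1 p i l0); rewrite -s12 lerDl.
  by apply: sumr_ge0 => c _; rewrite mulr_ge0 ?ler0n ?cell_ge0.
have q0 := pmf_ge0 q i.
rewrite ps; suff : 0 <= q i * (1 - s1) by lra.
by rewrite mulr_ge0 // subr_ge0.
Qed.

End Region.
End Signal.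

Lemma sum_geo_le (R : realFieldType) (c : R) (J : nat) : 0 <= c < 1 ->
  \sum_(j < J) c ^+ j <= (1 - c)^-1.
Proof.
move=> /andP[c0 c1]; have d0 : 0 < 1 - c by rewrite subr_gt0.
rewrite -[leRHS]mul1r ler_pdivlMr // mulrC.
have := subrX1 c J; rewrite -opprB -[c - 1]opprB => /(congr1 -%R).
by rewrite opprK mulNr opprK => <-; rewrite gerBl exprn_ge0.
Qed.

(** * Few boundary cells per scale force a large signal *)

Section SignalLowerBound.
Variables (R : realType) (n : nat) (p q : dist R n).

Lemma sum_wtV_le J : \sum_(j < J) (weight R j)^-1 <= 5.
Proof.
have -> : \sum_(j < J) (weight R j)^-1 = \sum_(j < J) (4 / 5) ^+ j.
  by apply: eq_bigr => j _; rewrite /weight -exprVn invf_div.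
apply: le_trans (sum_geo_le _ _) _; first by apply/andP; split; lra.
by rewrite (_ : 1 - 4 / 5 = 5^-1) ?invrK //; field.
Qed.

Lemma fulldev_signal_le (N : {set 'I_n}) (k J : nat) : (0 < k)%N ->
  (forall l, (0 < l)%N -> \sum_(c < l) (mixed p N l c)%:R <= k%:R :> R) ->
  fulldev p q N (k * 2 ^ J) ^+ 2 <= 10 * k%:R * signal p q k J.+1.
Proof.
move=> k0 mix.
have l0 j : (0 < k * 2 ^ j)%N by rewrite muln_gt0 k0 expn_gt0.
have lS j : (k * 2 ^ j.+1 = (k * 2 ^ j).*2)%N by rewrite expnS mulnCA mul2n.
pose a j := fulldev p q N (k * 2 ^ j).
(* Increments between consecutive scales: their sum telescopes to the finest scale, and each is
   controlled by k times the energy of its own scale. *)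
pose b j := if j is i.+1 then a i.+1 - a i else a 0%N.
have b2 j : b j ^+ 2 <= 2 * k%:R * dev2 p q (k * 2 ^ j).
  case: j => [|j] /=.
    rewrite /a expn0 muln1; apply: le_trans (fulldev_le _ _ _ _) _.
    have := mulr_ge0 (ler0n R k) (dev2_ge0 p q k); lra.
  rewrite /a lS; apply: le_trans (fulldev_double_le _ _ _ _) _.
  rewrite mulrA [2 * _]mulrC; apply: ler_wpM2r; first exact: dev2_ge0.
  by rewrite ler_pM2r // mix.
have -> : fulldev p q N (k * 2 ^ J) = \sum_(j < J.+1) b j.
  rewrite -/(a J); elim: J {lS l0} => [|J IH]; first by rewrite big_ord1.
  by rewrite big_ord_recr /= -IH; ring.
(* Sets up Cauchy-Schwarz with weights 1 / w_j, whose sum is at most 5; with the factor 2 of [b2]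
   this gives the constant 10. *)
have -> : \sum_(j < J.+1) b j = \sum_(j < J.+1) (weight R j)^-1 * (weight R j * b j).
  by apply: eq_bigr => j _; rewrite mulKf // gt_eqF ?weight_gt0.
apply: le_trans (jensen_sqr (fun j : 'I_J.+1 => weight R j * b j) _) _ => /=.
  by move=> j; rewrite invr_ge0 ltW ?weight_gt0.
have -> : \sum_(j < J.+1) (weight R j)^-1 * (weight R j * b j) ^+ 2
        = \sum_(j < J.+1) weight R j * b j ^+ 2.
  by apply: eq_bigr => j _; rewrite exprMn expr2 -mulrA mulKf // gt_eqF ?weight_gt0.
have -> : 10 * k%:R * signal p q k J.+1 = 5 * (2 * k%:R * signal p q k J.+1) by ring.
apply: ler_pM (sum_wtV_le _) _.
- by apply: sumr_ge0 => j _; rewrite invr_ge0 ltW ?weight_gt0.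
- by apply: sumr_ge0 => j _; rewrite mulr_ge0 ?sqr_ge0 // ltW ?weight_gt0.
rewrite /signal mulr_sumr; apply: ler_sum => j _.
by rewrite [leRHS]mulrCA ler_wpM2l ?b2 // ltW ?weight_gt0.
Qed.

(** A mixed cell meets two points on different sides of N, hence in different blocks, so some block
    starts strictly inside it; and each block starts strictly inside at most one cell. *)
Lemma sum_mixed_le (N : {set 'I_n}) (P : {set {set 'I_n}}) l :
  partition P [set: 'I_n] -> {in P, forall B, is_interval B} ->
  (forall i j, pblock P i = pblock P j -> (i \in N) = (j \in N)) ->
  (0 < l)%N -> \sum_(c < l) (mixed p N l c)%:R <= #|P|%:R :> R.
Proof.
move=> partP ivP Ndef l0.
have [covP trivP _] := and3P partP.
have lR : 0 < l%:R :> R by rewrite ltr0n.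
have inP i : pblock P i \in P by rewrite pblock_mem // (eqP covP) inE.
have iB i : i \in pblock P i by rewrite mem_pblock (eqP covP) inE.
pose start (B : {set 'I_n}) : nat := find (mem B) (enum 'I_n).
pose straddle c (B : {set 'I_n}) := c%:R / l%:R < cdf p (start B) < c.+1%:R / l%:R.
have startP i : (start (pblock P i) <= i)%N /\
    forall j : 'I_n, (j < i)%N -> pblock P j != pblock P i -> (j < start (pblock P i))%N.
  set B := pblock P i.
  have hasB : has (mem B) (enum 'I_n) by apply/hasP; exists i; [rewrite mem_enum | exact: iB].
  have sn : (start B < n)%N by move: hasB; rewrite has_find size_enum_ord.
  have sB : Ordinal sn \in B.
    have := nth_find (Ordinal sn) hasB; rewrite -/(start B).
    by rewrite (nth_ord_enum (Ordinal sn) (Ordinal sn)).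
  split.
    rewrite leqNgt; apply/negP => si.
    by have := before_find i si; rewrite nth_ord_enum [mem _ _]iB.
  move=> j ji; apply: contraNltn => sj.
  have /forallP /(_ (Ordinal sn)) /implyP /(_ sB) /forallP /(_ i) /implyP /(_ (iB i)) := ivP _ (inP i).
  move=> /forallP /(_ j); rewrite /= sj ltnW //= => jB.
  by apply/eqP; exact: def_pblock trivP (inP i) jB.
have mixS c : (c < l)%N -> mixed p N l c -> [exists B in P, straddle c B].
  move=> cl /andP[/forallPn[i] + /existsP[i' /andP[i'N ti']]].
  rewrite negb_imply => /andP[iN ti].
  (* The block of y starts after x, which is not in it, and no later than y, so the distribution
     function at its start lies strictly between the ends of the cell. *)
  have key (x y : 'I_n) : (x < y)%N -> (x \in N) != (y \in N) ->
      cell p l c x != 0 -> cell p l c y != 0 -> [exists B in P, straddle c B].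
    move=> xy Nxy /cell_neq0[_ tx] /cell_neq0[ty _].
    apply/existsP; exists (pblock P y); rewrite inP /straddle.
    have [sy sx] := startP y.
    have {}sx : (x < start (pblock P y))%N.
      by apply: sx => //; apply: contra_neq Nxy => /Ndef.
    by rewrite (lt_le_trans tx) ?(le_lt_trans _ ty) ?cdf_le.
  case: (ltngtP i i') => [lt_ii'|lt_i'i|/val_inj ii'].
  - by apply: key lt_ii' _ ti ti'; rewrite i'N (negbTE iN).
  - by apply: key lt_i'i _ ti' ti; rewrite i'N (negbTE iN).
  - by move: iN; rewrite ii' i'N.
apply: le_trans (_ : \sum_(c < l) \sum_(B in P) (straddle c B)%:R <= _).
  apply: ler_sum => c _; case: (boolP (mixed p N l c)) => [m|_]; last first.
    by apply: sumr_ge0 => B _; rewrite ler0n.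
  have /existsP[B /andP[BP sB]] := mixS c (ltn_ord c) m.
  rewrite (bigD1 B) //= sB lerDl; apply: sumr_ge0 => B' _; exact: ler0n.
rewrite exchange_big -sum1_card natr_sum /=; apply: ler_sum => B _.
have [/existsP[c sc]|/existsPn no] := boolP [exists c : 'I_l, straddle c B].
  rewrite (bigD1 c) //= sc big1 ?addr0 // => c' c'c.
  suff /negbTE -> : ~~ straddle c' B by [].
  apply: contra c'c; rewrite /straddle !ltr_pdivrMr // !ltr_pdivlMr // in sc * => sc'.
  move: sc sc' => /andP[a1 a2] /andP[b1 b2].
  have := lt_trans a1 b2; have := lt_trans b1 a2; rewrite !ltr_nat !ltnS => ? ?.
  by apply/eqP/val_inj/eqP; rewrite eqn_leq; apply/andP.
by rewrite big1 // => c _; rewrite (negbTE (no c)).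
Qed.

(** Positivity of eps rules out the default value 0 of the maximum. *)
Lemma Ak_dist_ex k (eps : R) : 0 < eps -> eps <= Ak_dist k q p ->
  exists2 P, interval_partition k P &
    eps <= \sum_(B in P) `|mass q B - mass p B|.
Proof.
move=> e0; rewrite /Ak_dist.
elim/big_ind: _ => [|x y Hx Hy|P HP h]; first by rewrite leNgt e0.
  by rewrite le_max => /orP[].
by exists P.
Qed.

Lemma sum_mass P : partition P [set: 'I_n] -> \sum_(B in P) mass q B = 1.
Proof.
case/and3P => /eqP cov triv _; rewrite /mass -(pmf_sum q).
rewrite -(big_trivIset _ triv) cov /=; by apply: eq_bigl => x; rewrite inE.
Qed.

(** The deficit of q on N is at least eps / 2, and at most k mixed cells of mass 1 / (k 2^J) lose at
    most eps / 4 of it. Then (eps / 4)^2 / (10 k) yields the constant 160. *)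
Lemma signal_ge k J (eps : R) : (0 < k)%N -> 0 < eps -> 4 <= 2 ^+ J * eps ->
  eps <= Ak_dist k q p -> eps ^+ 2 / (160 * k%:R) <= signal p q k J.+1.
Proof.
move=> k0 e0 Je /(Ak_dist_ex e0)[P /and3P[partP /eqP cardP /forallP ivP] eP].
have [covP trivP _] := and3P partP.
pose N := [set i | mass q (pblock P i) < mass p (pblock P i)].
have ivP' : {in P, forall B, is_interval B} by move=> B BP; apply: (implyP (ivP B)).
have mix l : (0 < l)%N -> \sum_(c < l) (mixed p N l c)%:R <= k%:R :> R.
  move=> l0; rewrite -cardP; apply: sum_mixed_le => // i j.
  by rewrite !inE => ->.
have NE : eps <= 2 * \sum_(i in N) (p i - q i).
  have -> : \sum_(i in N) (p i - q i) =
      \sum_(B in P) Num.max 0 (mass p B - mass q B).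
    have -> : \sum_(i in N) (p i - q i) =
        \sum_(i in cover P) (if i \in N then p i - q i else 0).
      by rewrite (eqP covP) big_mkcond; apply: eq_bigl => i; rewrite inE.
    rewrite (big_trivIset _ trivP) /=; apply: eq_bigr => B BP.
    rewrite (eq_bigr (fun i => if mass q B < mass p B then p i - q i else 0)) => [|i iB].
      case: ltP => h; last by rewrite big1 // max_l // subr_le0.
      by rewrite sumrB max_r // subr_ge0 ltW.
    by rewrite inE (def_pblock trivP BP iB).
  apply: le_trans eP _; rewrite -subr_ge0.
  rewrite mulr_sumr -sumrB.
  (* 2 max(0, y) - |y| = y, and these differences sum to 0 because both distributions have total
     mass 1. *)
  have -> : \sum_(B in P) (2 * Num.max 0 (mass p B - mass q B) - `|mass q B - mass p B|)
     = \sum_(B in P) (mass p B - mass q B).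
    apply: eq_bigr => B _; case: (ltP (mass p B) (mass q B)) => h.
      by rewrite max_l ?gtr0_norm; lra.
    by rewrite max_r ?ler0_norm; lra.
  rewrite sumrB; have -> : \sum_(B in P) mass p B = \sum_(B in P) mass q B; last by rewrite subrr.
  rewrite sum_mass // /mass -(pmf_sum p) -(big_trivIset _ trivP) (eqP covP) /=.
  by apply: eq_bigl => x; rewrite inE.
have kR : 0 < k%:R :> R by rewrite ltr0n.
have L0 : (0 < k * 2 ^ J)%N by rewrite muln_gt0 k0 expn_gt0.
have le1 := region_mass_le p q N L0.
have le2 := fulldev_signal_le J k0 mix.
set a := fulldev _ _ _ _ in le1 le2.
have le3 : (\sum_(c < k * 2 ^ J) (mixed p N (k * 2 ^ J) c)%:R) / (k * 2 ^ J)%:R <= eps / 4.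
  rewrite ler_pdivrMr ?ltr0n //; apply: le_trans (mix _ L0) _.
  rewrite natrM natrX mulrCA ler_peMr ?ler0n // mulrC; lra.
have le4 : eps / 4 <= - a by lra.
have le5 : (eps / 4) ^+ 2 <= a ^+ 2.
  by rewrite -[a ^+ 2]sqrrN ler_sqr ?nnegrE; lra.
rewrite ler_pdivrMr ?mulr_gt0 //; have := le_trans le5 le2; lra.
Qed.

End SignalLowerBound.

(** * Moments of the statistic *)

Section Variance.
Variables (R : realType) (n : nat) (p q : dist R n).

(** Centred at its mean under p, so that the mean under q is [dev], which vanishes when q = p. *)
Definition ccell (l c : nat) (x : 'I_n) : R := cell p l c x - l%:R^-1.

Definition lkernel (l : nat) (x y : 'I_n) : R :=
  \sum_(c < l) ccell l c x * ccell l c y.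

Definition kernel (k J : nat) (x y : 'I_n) : R :=
  \sum_(j < J) weight R j * lkernel (k * 2 ^ j) x y.

(** The Hoeffding projection of [lkernel] under q: its mean over one argument. *)
Definition lscore (l : nat) (x : 'I_n) : R := \sum_(c < l) ccell l c x * dev p q l c.

Definition score (k J : nat) (x : 'I_n) : R :=
  \sum_(j < J) weight R j * lscore (k * 2 ^ j) x.

Lemma cell_mass l c : (c < l)%N -> \sum_x q x * cell p l c x = l%:R^-1 + dev p q l c.
Proof.
move=> cl; rewrite -(sum_pmf_cell p cl) /dev -big_split /=.
by apply: eq_bigr => x _; ring.
Qed.

Lemma mean_ccell l c : (c < l)%N -> \sum_x q x * ccell l c x = dev p q l c.
Proof.
move=> cl; under eq_bigr do rewrite /ccell mulrBr.
by rewrite sumrB -mulr_suml pmf_sum mul1r cell_mass // addrC addKr.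
Qed.

Lemma mean_lkernel l x : \sum_y q y * lkernel l x y = lscore l x.
Proof.
under eq_bigr do rewrite /lkernel mulr_sumr.
rewrite exchange_big /=; apply: eq_bigr => c _.
by rewrite -(mean_ccell (ltn_ord c)) mulr_sumr; apply: eq_bigr => y _; rewrite mulrCA.
Qed.

Lemma mean_lscore l : \sum_x q x * lscore l x = dev2 p q l.
Proof.
under eq_bigr do rewrite /lscore mulr_sumr.
rewrite exchange_big /=; apply: eq_bigr => c _.
by under eq_bigr do rewrite mulrA; rewrite -mulr_suml mean_ccell // expr2.
Qed.

Lemma mean_kernel k J x : \sum_y q y * kernel k J x y = score k J x.
Proof.
under eq_bigr do rewrite /kernel mulr_sumr.
rewrite exchange_big /=; apply: eq_bigr => j _.
by rewrite -mean_lkernel mulr_sumr; apply: eq_bigr => y _; rewrite mulrCA.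
Qed.

Lemma mean_score k J : \sum_x q x * score k J x = signal p q k J.
Proof.
under eq_bigr do rewrite /score mulr_sumr.
rewrite exchange_big /=; apply: eq_bigr => j _.
by rewrite -mean_lscore mulr_sumr; apply: eq_bigr => y _; rewrite mulrCA.
Qed.

Lemma kernelC k J x y : kernel k J x y = kernel k J y x.
Proof. by apply: eq_bigr => j _; congr (_ * _); apply: eq_bigr => c _; rewrite mulrC. Qed.

Lemma sqrrD_le (a b : R) : (a + b) ^+ 2 <= 2 * a ^+ 2 + 2 * b ^+ 2.
Proof. by have := sqr_ge0 (a - b); rewrite sqrrB sqrrD; lra. Qed.

(** T is the chance that random points of the intervals of x and y share a cell, so T^2 <= T. The
    correction b due to centring is at most 1 / l in absolute value, also when points of p-mass zero
    belong to no cell. *)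
Lemma lkernel_sqr_le l x y : (0 < l)%N ->
  lkernel l x y ^+ 2 <= 2 * (\sum_(c < l) cell p l c x * cell p l c y) + 2 / l%:R ^+ 2.
Proof.
move=> l0; set T := \sum_(c < l) _.
have lR : 0 < l%:R :> R by rewrite ltr0n.
have sum_ge0 z : 0 <= \sum_(c < l) cell p l c z by apply: sumr_ge0 => c _; apply: cell_ge0.
have T0 : 0 <= T by apply: sumr_ge0 => c _; rewrite mulr_ge0 ?cell_ge0.
have T1 : T <= 1.
  apply: le_trans (sum_cell_le1 p x l0); apply: ler_sum => c _.
  apply: ler_piMr; first exact: cell_ge0.
  apply: le_trans (sum_cell_le1 p y l0); rewrite (bigD1 c) //= lerDl.
  by apply: sumr_ge0 => c' _; apply: cell_ge0.
pose b := (1 - \sum_(c < l) cell p l c x - \sum_(c < l) cell p l c y) / l%:R.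
have -> : lkernel l x y = T + b.
  rewrite /lkernel /ccell.
  have -> : T + b = \sum_(c < l) (cell p l c x * cell p l c y +
      (l%:R^-1 * l%:R^-1 - cell p l c x * l%:R^-1 - cell p l c y * l%:R^-1)).
    rewrite big_split /= !sumrB -!mulr_suml sumr_const card_ord.
    have -> : l%:R^-1 *+ l = 1 :> R by rewrite -[_ *+ l]mulr_natl divff // gt_eqF.
    by rewrite /b; congr (_ + _); ring.
  by apply: eq_bigr => c _; ring.
apply: le_trans (sqrrD_le _ _) _.
have TT : T ^+ 2 <= T by rewrite expr2 ler_piMl.
have bb : b ^+ 2 <= 1 / l%:R ^+ 2.
  rewrite /b expr_div_n ler_pM2r ?invr_gt0 ?exprn_gt0 // -real_normK ?num_real //.
  have := sum_cell_le1 p x l0; have := sum_cell_le1 p y l0.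
  have := sum_ge0 x; have := sum_ge0 y => *.
  by rewrite expr_le1 // ler_norml; apply/andP; split; lra.
by move: TT bb; rewrite mul1r; lra.
Qed.

(** Averaging T over x and y gives the sum of the squared cell masses 1 / l + D_c of q. *)
Lemma mean_lkernel_sqr_le l : (0 < l)%N ->
  \sum_x q x * (\sum_y q y * lkernel l x y ^+ 2) <= 6 / l%:R + 4 * dev2 p q l.
Proof.
move=> l0; have lR : 0 < l%:R :> R by rewrite ltr0n.
have l1 : 1 <= l%:R :> R by rewrite ler1n.
have massE : \sum_x q x * (\sum_y q y * \sum_(c < l) cell p l c x * cell p l c y)
    = \sum_(c < l) (l%:R^-1 + dev p q l c) ^+ 2.
  under eq_bigr => x _.
    under eq_bigr do rewrite mulr_sumr.
    rewrite exchange_big mulr_sumr /=; over.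
  rewrite exchange_big /=; apply: eq_bigr => c _.
  rewrite -(cell_mass (ltn_ord c)) expr2 mulr_suml; apply: eq_bigr => x _.
  by rewrite -mulrA [X in _ = _ * X]mulr_sumr; congr (_ * _); apply: eq_bigr => y _; rewrite mulrCA.
apply: le_trans (_ : 2 * (\sum_(c < l) (l%:R^-1 + dev p q l c) ^+ 2) + 2 / l%:R ^+ 2 <= _).
  rewrite -massE; have -> : 2 / l%:R ^+ 2 = \sum_x q x * (\sum_y q y * (2 / l%:R ^+ 2)).
    by under eq_bigr do rewrite -mulr_suml pmf_sum mul1r; rewrite -mulr_suml pmf_sum mul1r.
  rewrite mulr_sumr -big_split /=; apply: ler_sum => x _.
  rewrite [2 * _]mulrCA -mulrDr; apply: ler_wpM2l; first exact: pmf_ge0.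
  rewrite mulr_sumr -big_split /=; apply: ler_sum => y _.
  rewrite [2 * (q y * _)]mulrCA -mulrDr; apply: ler_wpM2l; first exact: pmf_ge0.
  exact: lkernel_sqr_le.
have : \sum_(c < l) (l%:R^-1 + dev p q l c) ^+ 2 <= 2 / l%:R + 2 * dev2 p q l.
  have -> : 2 / l%:R = \sum_(c < l) 2 * l%:R^-1 ^+ 2 :> R.
    by rewrite sumr_const card_ord -mulr_natl; field; rewrite gt_eqF.
  rewrite mulr_sumr -big_split /=; apply: ler_sum => c _.
  exact: sqrrD_le.
have : l%:R ^- 2 <= l%:R^-1 :> R.
  by rewrite lef_pV2 ?posrE ?exprn_gt0 // expr2 ler_peMr // ltW.
lra.
Qed.

(** Jensen over the cells of x moves the square onto D_c; the remaining weight is the q-mass of the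
    cell, 1 / l + D_c, and D_c is at most r. *)
Lemma mean_lscore_sqr_le l r : (0 < l)%N -> 0 <= r -> dev2 p q l <= r ^+ 2 ->
  \sum_x q x * lscore l x ^+ 2 <= (4 / l%:R + 2 * r) * dev2 p q l.
Proof.
move=> l0 r0 dr; have lR : 0 < l%:R :> R by rewrite ltr0n.
apply: le_trans (_ : \sum_x q x *
   (2 * (\sum_(c < l) cell p l c x * dev p q l c ^+ 2) + 2 * (dev2 p q l / l%:R)) <= _).
  apply: ler_sum => x _; apply: ler_wpM2l; first exact: pmf_ge0.
  have -> : lscore l x = \sum_(c < l) cell p l c x * dev p q l c
      + - \sum_(c < l) l%:R^-1 * dev p q l c.
    by rewrite -sumrB; apply: eq_bigr => c _; rewrite mulrBl.
  apply: le_trans (sqrrD_le _ _) _; rewrite sqrrN; apply: lerD; apply: ler_wpM2l => //.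
    apply: le_trans (jensen_sqr (fun c : 'I_l => dev p q l c)
       (fun c : 'I_l => cell_ge0 p l c x)) _.
    apply: ler_piMl (sum_cell_le1 p x l0).
    by apply: sumr_ge0 => c _; rewrite mulr_ge0 ?cell_ge0 ?sqr_ge0.
  apply: le_trans (jensen_sqr (fun c : 'I_l => dev p q l c) _) _.
    by move=> c; rewrite invr_ge0 ltW.
  by rewrite sumr_const card_ord -[_ *+ l]mulr_natl divff ?gt_eqF // mul1r -mulr_sumr mulrC.
under eq_bigr do rewrite mulrDr mulrCA.
rewrite big_split /= -mulr_suml pmf_sum mul1r -mulr_sumr.
suff : \sum_x q x * (\sum_(c < l) cell p l c x * dev p q l c ^+ 2)
   <= (l%:R^-1 + r) * dev2 p q l by lra.
under eq_bigr do rewrite mulr_sumr.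
rewrite exchange_big mulr_sumr /=; apply: ler_sum => c _.
under eq_bigr do rewrite mulrA.
rewrite -mulr_suml cell_mass //; apply: ler_wpM2r; first exact: sqr_ge0.
rewrite lerD2l; apply: le_trans (ler_norm _) _.
rewrite -(ler_sqr (x := `|_|)) ?nnegrE // real_normK ?num_real //.
apply: le_trans dr; rewrite /dev2 (bigD1 c) //= lerDl.
by apply: sumr_ge0 => c' _; apply: sqr_ge0.
Qed.

(* Jensen with the summable weights (15/16)^j = w_j (3/4)^j. *)
Lemma weighted_sqr_le J (z : nat -> R) :
  (\sum_(j < J) weight R j * z j) ^+ 2
    <= 16 * \sum_(j < J) (5 / 3) ^+ j * z j ^+ 2.
Proof.
have -> : \sum_(j < J) weight R j * z j =
    \sum_(j < J) (15 / 16) ^+ j * ((4 / 3) ^+ j * z j).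
  apply: eq_bigr => j _; rewrite mulrA -exprMn; congr (_ ^+ _ * _); lra.
apply: le_trans (jensen_sqr (fun j : 'I_J => (4 / 3) ^+ j * z j) _) _ => /=.
  by move=> j; rewrite exprn_ge0 //; lra.
apply: ler_pM.
- by apply: sumr_ge0 => j _; rewrite exprn_ge0 //; lra.
- by apply: sumr_ge0 => j _; rewrite mulr_ge0 ?sqr_ge0 // exprn_ge0 //; lra.
- apply: le_trans (sum_geo_le _ _) _; first by apply/andP; split; lra.
  by rewrite (_ : 1 - 15 / 16 = 16^-1) ?invrK //; field.
apply: ler_sum => j _; rewrite le_eqVlt; apply/orP; left; apply/eqP.
have -> : (5 / 3 : R) ^+ j = (15 / 16) ^+ j * ((4 / 3) ^+ j) ^+ 2.
  by rewrite -exprM mulnC exprM -exprMn; congr (_ ^+ _); lra.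
by ring.
Qed.

(** 5 / 3 = 4 / 3 * 5 / 4, with 4 / 3 crudely raised to 2. The loss 2^J affects only terms that
    carry the signal. *)
Lemma geo_weight_le j J : (j <= J)%N -> (5 / 3) ^+ j <= 2 ^+ J * weight R j.
Proof.
move=> jJ; have -> : (5 / 3 : R) ^+ j = (4 / 3) ^+ j * weight R j.
  by rewrite -exprMn; congr (_ ^+ _); lra.
apply: ler_wpM2r; first by rewrite ltW ?weight_gt0.
apply: le_trans (_ : 2 ^+ j <= _); last by rewrite ler_eXn2l //; lra.
by apply: lerXn2r; rewrite ?nnegrE; lra.
Qed.

(** At scale j the noise is 6 / (k 2^j); against (5 / 3)^j it leaves a geometric series of ratio 5 /
    6, so the pure noise stays O(1 / k) for any number of scales. *)
Lemma mean_kernel_sqr_le k J : (0 < k)%N ->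
  \sum_x q x * (\sum_y q y * kernel k J.+1 x y ^+ 2) <=
    576 / k%:R + 64 * 2 ^+ J * signal p q k J.+1.
Proof.
move=> k0; have kR : 0 < k%:R :> R by rewrite ltr0n.
have l0 j : (0 < k * 2 ^ j)%N by rewrite muln_gt0 k0 expn_gt0.
apply: le_trans (_ : \sum_x q x * (\sum_y q y *
   (16 * \sum_(j < J.+1) (5 / 3) ^+ j * lkernel (k * 2 ^ j) x y ^+ 2)) <= _).
  apply: ler_sum => x _; apply: ler_wpM2l; first exact: pmf_ge0.
  apply: ler_sum => y _; apply: ler_wpM2l; first exact: pmf_ge0.
  exact: (weighted_sqr_le J.+1 (fun j => lkernel (k * 2 ^ j) x y)).
have -> : \sum_x q x * (\sum_y q y *
   (16 * \sum_(j < J.+1) (5 / 3) ^+ j * lkernel (k * 2 ^ j) x y ^+ 2))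
  = 16 * \sum_(j < J.+1) (5 / 3) ^+ j *
       \sum_x q x * (\sum_y q y * lkernel (k * 2 ^ j) x y ^+ 2).
  rewrite mulr_sumr; under [RHS]eq_bigr do rewrite !mulr_sumr.
  rewrite exchange_big /=; apply: eq_bigr => x _.
  under [RHS]eq_bigr do rewrite !mulr_sumr.
  rewrite mulr_sumr exchange_big /=; apply: eq_bigr => y _.
  by rewrite !mulr_sumr; apply: eq_bigr => j _; ring.
have -> : 576 / k%:R + 64 * 2 ^+ J * signal p q k J.+1
  = 16 * (36 / k%:R + 4 * (2 ^+ J * signal p q k J.+1)) by ring.
rewrite ler_pM2l //.
apply: le_trans (_ : \sum_(j < J.+1) ((5 / 6) ^+ j * (6 / k%:R) +
   4 * (2 ^+ J * (weight R j * dev2 p q (k * 2 ^ j)))) <= _).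
  apply: ler_sum => j _.
  apply: le_trans (ler_wpM2l _ (mean_lkernel_sqr_le (l0 j))) _.
    by rewrite exprn_ge0 //; lra.
  rewrite mulrDr; apply: lerD.
    have -> : (5 / 6 : R) ^+ j = (5 / 3) ^+ j / 2 ^+ j.
      by rewrite -expr_div_n; congr (_ ^+ _); lra.
    rewrite natrM natrX le_eqVlt; apply/orP; left; apply/eqP.
    by field; rewrite !gt_eqF ?exprn_gt0.
  rewrite mulrCA ler_pM2l // mulrA; apply: ler_wpM2r; first exact: dev2_ge0.
  by apply: geo_weight_le; rewrite -ltnS.
rewrite big_split /= -mulr_sumr -mulr_sumr -mulr_suml lerD2r.
have -> : 36 / k%:R = 6 * (6 / k%:R) :> R by ring.
apply: ler_wpM2r; first by rewrite divr_ge0 // ltW.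
apply: le_trans (sum_geo_le _ _) _; first by apply/andP; split; lra.
by rewrite (_ : 1 - 5 / 6 = 6^-1) ?invrK //; field.
Qed.

Lemma mean_score_sqr_le k J r : (0 < k)%N -> 0 <= r -> r ^+ 2 = signal p q k J.+1 ->
  \sum_x q x * score k J.+1 x ^+ 2 <=
    (64 / k%:R + 32 * 2 ^+ J * r) * signal p q k J.+1.
Proof.
move=> k0 r0 rS; have kR : 0 < k%:R :> R by rewrite ltr0n.
have l0 j : (0 < k * 2 ^ j)%N by rewrite muln_gt0 k0 expn_gt0.
have dr (j : 'I_J.+1) : dev2 p q (k * 2 ^ j) <= r ^+ 2.
  rewrite rS /signal (bigD1 j) //=.
  apply: le_trans (_ : weight R j * dev2 p q (k * 2 ^ j) <= _).
    by rewrite ler_peMl ?dev2_ge0 // exprn_ege1 //; lra.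
  rewrite lerDl; apply: sumr_ge0 => i _.
  by rewrite mulr_ge0 ?dev2_ge0 // ltW ?weight_gt0.
apply: le_trans (_ : \sum_x q x *
   (16 * \sum_(j < J.+1) (5 / 3) ^+ j * lscore (k * 2 ^ j) x ^+ 2) <= _).
  apply: ler_sum => x _; apply: ler_wpM2l; first exact: pmf_ge0.
  exact: (weighted_sqr_le J.+1 (fun j => lscore (k * 2 ^ j) x)).
have -> : \sum_x q x * (16 * \sum_(j < J.+1) (5 / 3) ^+ j * lscore (k * 2 ^ j) x ^+ 2)
  = 16 * \sum_(j < J.+1) (5 / 3) ^+ j * \sum_x q x * lscore (k * 2 ^ j) x ^+ 2.
  rewrite mulr_sumr; under [RHS]eq_bigr do rewrite !mulr_sumr.
  rewrite exchange_big /=; apply: eq_bigr => x _.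
  by rewrite !mulr_sumr; apply: eq_bigr => j _; ring.
have -> : (64 / k%:R + 32 * 2 ^+ J * r) * signal p q k J.+1
  = 16 * ((4 / k%:R + 2 * (2 ^+ J * r)) * signal p q k J.+1) by ring.
rewrite ler_pM2l // /signal mulr_sumr; apply: ler_sum => j _.
apply: le_trans (ler_wpM2l _ (mean_lscore_sqr_le (l0 j) r0 (dr j))) _.
  by rewrite exprn_ge0 //; lra.
rewrite [leLHS]mulrA [leRHS]mulrA; apply: ler_wpM2r; first exact: dev2_ge0.
rewrite [leLHS]mulrDr [leRHS]mulrDl; apply: lerD.
  rewrite natrM natrX.
  have -> : (5 / 3) ^+ j * (4 / (k%:R * 2 ^+ j)) = (4 / k%:R) * ((5 / 3) ^+ j / 2 ^+ j) :> R.
    by field; rewrite !gt_eqF ?exprn_gt0.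
  (* 5 / 6 is raised to 5 / 4 in order to recover the weights of the signal. *)
  rewrite ler_pM2l ?divr_gt0 // -expr_div_n; apply: lerXn2r; rewrite ?nnegrE; lra.
have -> : (5 / 3) ^+ j * (2 * r) = 2 * r * (5 / 3) ^+ j by rewrite mulrC.
have -> : 2 * (2 ^+ J * r) * weight R j = 2 * r * (2 ^+ J * weight R j) by ring.
apply: ler_wpM2l; first by rewrite mulr_ge0.
by apply: geo_weight_le; rewrite -ltnS.
Qed.

End Variance.

Section Statistic.
Variables (R : realType) (n : nat) (p q : dist R n) (k J M : nat).

Definition stat (X Y : seq 'I_n) : R :=
  \sum_(y <- Y) \sum_(x <- X) kernel p k J x y.

Notation E f := (Esamp q M (fun X => Esamp q M (fun Y => f X Y))).

Lemma mean_stat : E stat = M%:R ^+ 2 * signal p q k J.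
Proof.
under eq_Esamp => X _.
  rewrite Esamp_sum_iid.
  have -> : \sum_y q y * (\sum_(x <- X) kernel p k J x y) = \sum_(x <- X) score p q k J x.
    under eq_bigr do rewrite mulr_sumr.
    by rewrite exchange_big /=; apply: eq_bigr => x _; rewrite mean_kernel.
  over.
by rewrite EsampZ Esamp_sum_iid mean_score expr2 mulrA.
Qed.

(** Two index pairs (x, y) coincide in M^2 cases, share exactly one coordinate in 2 M^2 (M - 1), and
    are disjoint in the remaining (M (M - 1))^2. *)
Lemma mean_stat_sqr : E (fun X Y => stat X Y ^+ 2) =
  M%:R ^+ 2 * (\sum_x q x * (\sum_y q y * kernel p k J x y ^+ 2))
  + 2 * M%:R ^+ 2 * (M%:R - 1) * (\sum_x q x * score p q k J x ^+ 2)
  + (M%:R * (M%:R - 1) * signal p q k J) ^+ 2.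
Proof.
under eq_Esamp => X _.
  rewrite Esamp_sqr_sum_iid.
  have -> : \sum_y q y * (\sum_(x <- X) kernel p k J x y) = \sum_(x <- X) score p q k J x.
    under eq_bigr do rewrite mulr_sumr.
    by rewrite exchange_big /=; apply: eq_bigr => x _; rewrite mean_kernel.
  over.
rewrite EsampD !EsampZ Esamp_sum Esamp_sqr_sum_iid mean_score.
have -> : \sum_y Esamp q M (fun X => q y * (\sum_(x <- X) kernel p k J x y) ^+ 2)
  = M%:R * (\sum_x q x * (\sum_y q y * kernel p k J x y ^+ 2))
    + M%:R * (M%:R - 1) * \sum_y q y * score p q k J y ^+ 2.
  under eq_bigr => y _.
    rewrite EsampZ Esamp_sqr_sum_iid.
    under [X in _ * (_ * _ + _ * X ^+ 2)]eq_bigr do rewrite kernelC.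
    rewrite mean_kernel mulrDr; over.
  rewrite big_split /= !mulr_sumr; congr (_ + _); apply: eq_bigr => y _.
    rewrite [LHS]mulrCA; congr (_ * (_ * _)); apply: eq_bigr => x _.
    by rewrite kernelC.
  by rewrite mulrCA.
by ring.
Qed.

Lemma var_stat : E (fun X Y => (stat X Y - M%:R ^+ 2 * signal p q k J) ^+ 2) <=
  M%:R ^+ 2 * (\sum_x q x * (\sum_y q y * kernel p k J x y ^+ 2))
  + 2 * M%:R ^+ 3 * (\sum_x q x * score p q k J x ^+ 2).
Proof.
set S := signal p q k J; set m := _ * S.
have -> : E (fun X Y => (stat X Y - m) ^+ 2) =
   E (fun X Y => stat X Y ^+ 2) - 2 * m * E stat + m ^+ 2.
  under eq_Esamp => X _.
    under eq_Esamp => Y _.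
      have -> : (stat X Y - m) ^+ 2 = (stat X Y ^+ 2 + (- 2 * m) * stat X Y) + m ^+ 2 by ring.
      over.
    rewrite EsampD EsampD EsampZ Esamp_cst; over.
  by rewrite EsampD EsampD EsampZ Esamp_cst; ring.
rewrite mean_stat mean_stat_sqr -/S /m.
set a := \sum_x q x * (\sum_y _); set b := \sum_x _.
have b0 : 0 <= b by apply: sumr_ge0 => x _; rewrite mulr_ge0 ?pmf_ge0 ?sqr_ge0.
have S0 : 0 <= S by apply: signal_ge0.
have M0 : 0 <= M%:R :> R by apply: ler0n.
rewrite -subr_ge0.
have -> : M%:R ^+ 2 * a + 2 * M%:R ^+ 3 * b - (M%:R ^+ 2 * a + 2 * M%:R ^+ 2 * (M%:R - 1) * b +
   (M%:R * (M%:R - 1) * S) ^+ 2 - 2 * (M%:R ^+ 2 * S) * (M%:R ^+ 2 * S) + (M%:R ^+ 2 * S) ^+ 2)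
   = M%:R ^+ 2 * (2 * b + (M%:R + (M%:R - 1)) * S ^+ 2) by ring.
(* The factor 2 M - 1 is negative at M = 0. *)
case: (posnP M) => [->|Mp]; first by rewrite expr0n mul0r.
have M1 : 1 <= M%:R :> R by rewrite ler1n.
rewrite mulr_ge0 ?sqr_ge0 // addr_ge0 ?mulr_ge0 ?sqr_ge0 //; lra.
Qed.

Lemma chebyshev_stat (a : R) (b : seq 'I_n -> seq 'I_n -> bool) : 0 < a ->
  (forall X Y, b X Y -> a <= `|stat X Y - M%:R ^+ 2 * signal p q k J|) ->
  E (fun X Y => (b X Y)%:R) <= E (fun X Y => (stat X Y - M%:R ^+ 2 * signal p q k J) ^+ 2) / a ^+ 2.
Proof.
move=> a0 H; rewrite mulrC -EsampZ; apply: ler_Esamp => X _.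
rewrite -EsampZ; apply: ler_Esamp => Y _.
rewrite mulrC ler_pdivlMr ?exprn_gt0 //.
case: (boolP (b X Y)) => [bXY|_]; last by rewrite mul0r sqr_ge0.
rewrite mul1r -[leRHS]real_normK ?num_real // ler_sqr ?nnegrE //; first exact: H.
exact: ltW.
Qed.

End Statistic.

(** * Error probabilities of the threshold test *)

Section Decision.
Variables (R : realType) (n : nat) (p : dist R n) (k J M : nat) (eps : R).
Hypotheses (k0 : (0 < k)%N) (e0 : 0 < eps) (e2 : eps <= 2).
(** [Jlo] makes the finest cells small enough for [signal_ge], [Jhi] bounds the loss 2^J of the
    variance by 8 / eps, and [Mlo] says that M >= 10^6 sqrt k / eps^2. *)
Hypothesis Jlo : 4 <= 2 ^+ J * eps.
Hypothesis Jhi : 2 ^+ J * eps <= 8.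
Hypothesis Mlo : 1000 ^+ 4 * k%:R <= M%:R ^+ 2 * eps ^+ 4.

Let kR : 0 < k%:R :> R. Proof. by rewrite ltr0n. Qed.

Let Mp : 0 < M%:R :> R.
Proof.
rewrite ltr0n lt0n; apply/eqP => M0; move: Mlo.
by rewrite M0 expr0n mul0r leNgt mulr_gt0 ?exprn_gt0.
Qed.

(* Half of the mean M ^ 2 * S guaranteed by signal_ge on far distributions. *)
Definition threshold : R := M%:R ^+ 2 * (eps ^+ 2 / (320 * k%:R)).

Let thr_gt0 : 0 < threshold.
Proof. by rewrite mulr_gt0 ?exprn_gt0 ?divr_gt0 ?exprn_gt0 ?mulr_gt0. Qed.

Notation accept := (fun X Y => stat p k J.+1 X Y <= threshold).

(** Signal and score vanish in mean square, so only the noise 576 / k of the kernel is compared with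
    the threshold. *)
Lemma reject_null :
  Esamp p M (fun X => Esamp p M (fun Y => (~~ accept X Y)%:R)) <= 3^-1.
Proof.
have S0 : signal p p k J.+1 = 0.
  rewrite /signal big1 // => j _; rewrite /dev2 big1 ?mulr0 // => c _.
  by rewrite /dev big1 ?expr0n // => x _; rewrite subrr mul0r.
have hE := @mean_score_sqr_le R n p p k J 0 k0 (lexx 0).
rewrite S0 expr0n /= in hE; have {}hE := hE erefl; rewrite mulr0 in hE.
have kE := @mean_kernel_sqr_le R n p p k J k0; rewrite S0 mulr0 addr0 in kE.
have V := var_stat p p k J.+1 M.
apply: le_trans (@chebyshev_stat R n p p k J.+1 M threshold _ thr_gt0 _) _.
  by move=> X Y; rewrite -ltNge S0 mulr0 subr0 => /ltW h; apply: le_trans h (ler_norm _).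
rewrite ler_pdivrMr ?exprn_gt0 //; apply: le_trans V _.
apply: le_trans (_ : M%:R ^+ 2 * (576 / k%:R) + 2 * M%:R ^+ 3 * 0 <= _).
  by apply: lerD; apply: ler_wpM2l => //; rewrite ?mulr_ge0 ?exprn_ge0 // ltW.
rewrite mulr0 addr0 /threshold.
have -> : 3^-1 * (M%:R ^+ 2 * (eps ^+ 2 / (320 * k%:R))) ^+ 2 =
   M%:R ^+ 2 * ((M%:R ^+ 2 * eps ^+ 4) / (3 * 320 ^+ 2 * k%:R ^+ 2)).
  by field; rewrite !gt_eqF.
rewrite ler_pM2l ?exprn_gt0 //.
rewrite ler_pdivlMr ?mulr_gt0 ?exprn_gt0 //; apply: le_trans Mlo.
have -> : 576 / k%:R * (3 * 320 ^+ 2 * k%:R ^+ 2) = (576 * 3 * 320 ^+ 2) * k%:R :> R.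
  by field; rewrite gt_eqF.
rewrite ler_pM2r //; lra.
Qed.

(** The threshold is at most half the mean, so acceptance is a deviation by M^2 S / 2. Each of the
    four variance terms gets a quarter of the budget M^2 S^2 / 12, after division by M^2. *)
Lemma accept_far (q : dist R n) : eps <= Ak_dist k q p ->
  Esamp q M (fun X => Esamp q M (fun Y => (accept X Y)%:R)) <= 3^-1.
Proof.
move=> far; have Sge := signal_ge k0 e0 Jlo far.
set S := signal _ _ _ _ in Sge.
have S0 : 0 < S by apply: lt_le_trans Sge; rewrite divr_gt0 ?exprn_gt0 ?mulr_gt0.
pose r := Num.sqrt S; have r0 : 0 < r by rewrite sqrtr_gt0.
have rS : r ^+ 2 = S by rewrite sqr_sqrtr // ltW.
have hE := mean_score_sqr_le k0 (ltW r0) rS; rewrite -/S in hE.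
have kE := @mean_kernel_sqr_le R n p q k J k0; rewrite -/S in kE.
have V := var_stat p q k J.+1 M.
have a0 : 0 < M%:R ^+ 2 * S / 2 by rewrite divr_gt0 // mulr_gt0 ?exprn_gt0.
have thr : threshold <= M%:R ^+ 2 * S / 2.
  rewrite /threshold -mulrA ler_pM2l ?exprn_gt0 //.
  apply: le_trans (_ : eps ^+ 2 / (160 * k%:R) / 2 <= _); last by rewrite ler_pM2r ?invr_gt0.
  by rewrite le_eqVlt; apply/orP; left; apply/eqP; field; rewrite gt_eqF.
apply: le_trans (@chebyshev_stat R n p q k J.+1 M _ _ a0 _) _.
  move=> X Y h; rewrite -/S distrC; apply: le_trans (ler_norm _); lra.
rewrite ler_pdivrMr ?exprn_gt0 //; apply: le_trans V _.
move: Mp Mlo a0 thr kE hE Jhi; set m := M%:R; set B := 2 ^+ J.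
move=> m_gt0 m_lo a0 thr kE hE B_hi.
have B0 : 0 < B by rewrite exprn_gt0.
apply: le_trans (_ : m ^+ 2 * (576 / k%:R + 64 * B * S)
   + 2 * m ^+ 3 * ((64 / k%:R + 32 * B * r) * S) <= _).
  by apply: lerD; apply: ler_wpM2l => //; rewrite ?mulr_ge0 ?exprn_ge0 // ltW.
have -> : 3^-1 * (m ^+ 2 * S / 2) ^+ 2 = m ^+ 2 * (m ^+ 2 * S ^+ 2 / 12) by field.
have -> : m ^+ 2 * (576 / k%:R + 64 * B * S) + 2 * m ^+ 3 * ((64 / k%:R + 32 * B * r) * S)
  = m ^+ 2 * (576 / k%:R + 64 * B * S + 2 * m * (64 / k%:R + 32 * B * r) * S) by ring.
rewrite ler_pM2l ?exprn_gt0 //.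
have m2 : 0 < m ^+ 2 by rewrite exprn_gt0.
have SkE : eps ^+ 2 <= S * (160 * k%:R) by rewrite -ler_pdivrMr ?mulr_gt0.
have mS : 0 < m * S by rewrite mulr_gt0.
have e4 : eps ^+ 4 = eps ^+ 2 * eps ^+ 2 by ring.
(* The sample size is used in two forms, trading eps^2 for S by [SkE]: [me] pays for the terms in B,
   [mk] for those in 1 / k. *)
have mek : 1000 ^+ 4 * k%:R <= m ^+ 2 * eps ^+ 2 * (S * (160 * k%:R)).
  apply: le_trans m_lo _; rewrite e4 mulrA ler_wpM2l // ltW // mulr_gt0 // exprn_gt0 //.
have me : 1000 ^+ 4 <= m ^+ 2 * eps ^+ 2 * S * 160.
  by rewrite -(ler_pM2r kR); apply: le_trans mek _; rewrite !mulrA.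
have mk : 1000 ^+ 4 <= m ^+ 2 * S ^+ 2 * (160 ^+ 2 * k%:R).
  apply: le_trans me _.
  have -> : m ^+ 2 * S ^+ 2 * (160 ^+ 2 * k%:R) = m ^+ 2 * S * 160 * (S * (160 * k%:R)) by ring.
  have -> : m ^+ 2 * eps ^+ 2 * S * 160 = m ^+ 2 * S * 160 * eps ^+ 2 by ring.
  by rewrite ler_pM2l // !mulr_gt0.
have t1 : 576 / k%:R <= m ^+ 2 * S ^+ 2 / 48.
  rewrite ler_pdivrMr //; move: mk; lra.
have t2 : 64 * B * S <= m ^+ 2 * S ^+ 2 / 48.
  (* 3072 = 64 * 48, to meet the share 1 / 48. *)
  have : 3072 * B <= m ^+ 2 * S.
    rewrite -(ler_pM2r e0); apply: le_trans (_ : 3072 * 8 <= _); first by lra.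
    rewrite -(ler_pM2r e0) -(ler_pM2r (_ : 0 < 160)) //.
    have -> : m ^+ 2 * S * eps * eps * 160 = m ^+ 2 * eps ^+ 2 * S * 160 by ring.
    apply: le_trans me; have := e2; lra.
  move=> h; have := ler_wpM2r (ltW S0) h.
  have -> : m ^+ 2 * S * S = m ^+ 2 * S ^+ 2 by ring.
  lra.
have mS_sqr (a b : R) : 0 <= a -> 0 <= b -> a ^+ 2 <= b ^+ 2 -> a <= b.
  by move=> a_ge b_ge; rewrite ler_sqr ?nnegrE.
have t3 : 2 * m * (64 / k%:R) * S <= m ^+ 2 * S ^+ 2 / 48.
  have h : 6144 / k%:R <= m * S.
    apply: mS_sqr; [by rewrite divr_ge0 // ltW | exact: ltW |].
    rewrite expr_div_n ler_pdivrMr ?exprn_gt0 // exprMn.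
    have k1 : 1 <= k%:R :> R by rewrite ler1n.
    have : m ^+ 2 * S ^+ 2 * k%:R <= m ^+ 2 * S ^+ 2 * k%:R ^+ 2.
      rewrite ler_pM2l ?mulr_gt0 ?exprn_gt0 //; rewrite expr2 ler_peMr // ltW //.
    move: mk; lra.
  have := ler_wpM2r (ltW mS) h.
  have -> : m * S * (m * S) = m ^+ 2 * S ^+ 2 by ring.
  have -> : 2 * m * (64 / k%:R) * S = 6144 / k%:R * (m * S) / 48 by field; rewrite gt_eqF.
  by rewrite ler_pM2r // invr_gt0.
have t4 : 2 * m * (32 * B * r) * S <= m ^+ 2 * S ^+ 2 / 48.
  have h : 3072 * B <= m * r.
    apply: mS_sqr; [by rewrite mulr_ge0 // ltW | by rewrite mulr_ge0 // ltW |].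
    rewrite !exprMn rS.
    rewrite -(ler_pM2r (exprn_gt0 2 e0)) -(ler_pM2r (_ : 0 < 160)) //.
    have -> : m ^+ 2 * S * eps ^+ 2 * 160 = m ^+ 2 * eps ^+ 2 * S * 160 by ring.
    apply: le_trans me.
    have -> : 3072 ^+ 2 * B ^+ 2 * eps ^+ 2 * 160 = 3072 ^+ 2 * 160 * (B * eps) ^+ 2 by ring.
    have : (B * eps) ^+ 2 <= 8 ^+ 2 by rewrite ler_sqr ?nnegrE // mulr_ge0 // ltW.
    lra.
  have mrS : 0 <= m * r * S by rewrite !mulr_ge0 // ltW.
  have := ler_wpM2r mrS h.
  have -> : m * r * (m * r * S) = m ^+ 2 * S ^+ 2 by rewrite -rS; ring.
  have -> : 2 * m * (32 * B * r) * S = 3072 * B * (m * r * S) / 48 by field.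
  by rewrite ler_pM2r // invr_gt0.
move: t1 t2 t3 t4.
have -> : 2 * m * (64 / k%:R + 32 * B * r) * S =
   2 * m * (64 / k%:R) * S + 2 * m * (32 * B * r) * S by ring.
lra.
Qed.

End Decision.

(** * The program and its execution *)

Section Execution.
Variables (R : realType) (sample : nat -> nat) (coin : nat -> bool).

(** A total-correctness triple with a time bound; quantifying over the rest of the stack is what
    lets triples be composed. *)
Definition execs (c : cmd) (st : state R) (t : nat) (Q : state R -> Prop) : Prop :=
  exists t' st', [/\ (t' <= t)%N,
    forall rest, iter t' (step sample coin) (c :: rest, st) = (rest, st') & Q st'].

Lemma execs_weaken c st t t' (Q Q' : state R -> Prop) :
  execs c st t Q -> (t <= t')%N -> (forall st', Q st' -> Q' st') -> execs c st t' Q'.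
Proof.
move=> [u [st' [ut run HQ]]] tt' QQ'; exists u, st'; split=> //; last exact: QQ'.
exact: leq_trans tt'.
Qed.

Lemma execs_le c st t t' (Q : state R -> Prop) :
  execs c st t Q -> (t <= t')%N -> execs c st t' Q.
Proof. by move=> H tt'; apply: execs_weaken H tt' _. Qed.

Lemma execs_nset a i e nm rm dr fl (Q : state R -> Prop) :
  let st := State nm rm dr fl in
  Q (State (upd nm a (neval st i) (neval st e)) rm dr fl) -> execs (NSet a i e) st 1 Q.
Proof. by move=> st HQ; exists 1%N; eexists; split; last exact: HQ. Qed.

Lemma execs_rset a i e nm rm dr fl (Q : state R -> Prop) :
  let st := State nm rm dr fl in
  Q (State nm (upd rm a (neval st i) (reval st e)) dr fl) -> execs (RSet a i e) st 1 Q.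
Proof. by move=> st HQ; exists 1%N; eexists; split; last exact: HQ. Qed.

Lemma execs_draw a i nm rm dr fl (Q : state R -> Prop) :
  let st := State nm rm dr fl in
  Q (State (upd nm a (neval st i) (sample dr)) rm dr.+1 fl) -> execs (Draw a i) st 1 Q.
Proof. by move=> st HQ; exists 1%N; eexists; split; last exact: HQ. Qed.

Lemma execs_skip st (Q : state R -> Prop) : Q st -> execs Skip st 1 Q.
Proof. by case: st => nm rm dr fl HQ; exists 1%N; eexists; split; last exact: HQ. Qed.

Lemma execs_seq c1 c2 st t1 t2 (Q : state R -> Prop) :
  execs c1 st t1 (fun st' => execs c2 st' t2 Q) -> execs (Seq c1 c2) st (t1 + t2).+1 Q.
Proof.
move=> [u1 [st1 [u1t run1 [u2 [st2 [u2t run2 HQ]]]]]].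
exists (u2 + u1).+1, st2; split=> // [|rest].
  by rewrite ltnS addnC leq_add.
by rewrite iterSr [step _ _ _]/=; case: st run1 => nm rm dr fl run1; rewrite iterD run1 run2.
Qed.

Lemma execs_if b c1 c2 st t (Q : state R -> Prop) :
  execs (if beval st b then c1 else c2) st t Q -> execs (If b c1 c2) st t.+1 Q.
Proof.
move=> [u [st' [ut run HQ]]]; exists u.+1, st'; split=> // rest.
by rewrite iterSr /=; case: st run => nm rm dr fl run; rewrite run.
Qed.

(** The invariant is indexed by the round, so the loop makes exactly N rounds; each pays one step
    for its test, and the last failing test pays one more. *)
Lemma execs_while b c t N (I : nat -> state R -> Prop) st :
  I 0%N st ->
  (forall i st', (i < N)%N -> I i st' -> beval st' b) ->
  (forall st', I N st' -> ~~ beval st' b) ->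
  (forall i st', (i < N)%N -> I i st' -> execs c st' t (I i.+1)) ->
  execs (While b c) st (N * t.+1).+1 (I N).
Proof.
move=> I0 Hb HN Hc.
suff : forall d i st, (d + i = N)%N -> I i st -> execs (While b c) st (d * t.+1).+1 (I N).
  by move=> H; apply: H I0; rewrite addn0.
elim=> [|d IH] i st' dN Ii.
  rewrite add0n in dN; subst i; exists 1%N, st'; split=> // rest /=.
  by case: st' Ii => nm rm dr fl Ii; rewrite (negbTE (HN _ Ii)).
have iN : (i < N)%N by rewrite -dN addSn ltnS leq_addl.
have [u [st1 [ut run1 I1]]] := Hc i st' iN Ii.
have [v [st2 [vt run2 I2]]] := IH i.+1 st1 (etrans (addnS _ _) dN) I1.
exists (v + u).+1, st2; split=> // [|rest].
  by rewrite ltnS mulSn; lia.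
have bi := Hb _ _ iN Ii.
rewrite iterSr; case: st' run1 bi {Ii} => nm rm dr fl run1 bi /=.
by rewrite bi iterD run1 run2.
Qed.

(** A halted configuration is a fixed point of [step], so surplus time is idle. *)
Lemma execs_halt c st t T (Q : state R -> Prop) : execs c st t Q -> (t <= T)%N ->
  exists2 st', iter T (step sample coin) ([:: c], st) = ([::], st') & Q st'.
Proof.
move=> [u [st' [ut run HQ]]] tT; exists st' => //.
rewrite -(subnK (leq_trans ut tT)) iterD run.
by elim: (T - u)%N => //= d ->; case: st' {run HQ}.
Qed.

End Execution.

Local Notation nvar a := (NGet a (NLit 0)).
Local Notation rvar a := (RGet a (NLit 0)).
Local Notation nsuc e := (NAdd e (NLit 1)).
Local Notation rlit c := (RNat (NLit c)).
Local Notation nlt e1 e2 := (BNot (BNle e2 e1)).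

(** Natural arrays: 2 holds M, 3 and 4 the batches, 5 a loop index, 6 the cell c, 7 the number l of
    cells. Real arrays: 3 holds the running distribution function, 4 and 5 the two batch sums, 6 the
    statistic, 7 the weight. *)
Local Notation vn := (NGet 0 (NLit 0)).
Local Notation vk := (NGet 0 (NLit 1)).
Local Notation veps := (rvar 0).
Local Notation vM := (nvar 2).
Local Notation vi := (nvar 5).
Local Notation vc := (nvar 6).
Local Notation vl := (nvar 7).

Definition reps2 := RMul veps veps.
Definition rM2 := RMul (RNat vM) (RNat vM).

(** With neither square root nor floor, M is found by drawing until M^2 eps^4 reaches 1000^4 k. *)
Definition draw_first : cmd :=
  While (BNot (BRle (RMul (RMul (RMul (rlit 1000) (rlit 1000)) (RMul (rlit 1000) (rlit 1000))) (RNat vk))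
              (RMul rM2 (RMul reps2 reps2))))
    (Seq (Draw 3 vM) (NSet 2 (NLit 0) (nsuc vM))).

Definition draw_second : cmd :=
  While (nlt vi vM) (Seq (Draw 4 vi) (NSet 5 (NLit 0) (nsuc vi))).

Definition rlo := RDiv (RNat vc) (RNat vl).
Definition rhi := RDiv (RNat (nsuc vc)) (RNat vl).

(* Real array 2 receives, for each i, the length of [0, p_0 + ... + p_(i-1)]
   inside the current cell [c/l, (c+1)/l]. *)
Definition fill_overlaps : cmd :=
  Seq (NSet 5 (NLit 0) (NLit 0)) (Seq (RSet 3 (NLit 0) (rlit 0))
  (While (nlt vi vn)
    (Seq (RSet 3 (NLit 0) (RAdd (rvar 3) (RGet 1 vi)))
    (Seq (If (BRle (rvar 3) rlo) (RSet 2 (nsuc vi) (rlit 0))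
         (If (BRle (rvar 3) rhi) (RSet 2 (nsuc vi) (RSub (rvar 3) rlo))
             (RSet 2 (nsuc vi) (RSub rhi rlo))))
         (NSet 5 (NLit 0) (nsuc vi)))))).

(** Division by p x = 0 gives 0 on the machine too, in agreement with [ucell]. *)
Definition rfrac (a : nat) :=
  RDiv (RSub (RGet 2 (nsuc (NGet a vi))) (RGet 2 (NGet a vi))) (RGet 1 (NGet a vi)).

Definition sum_samples : cmd :=
  Seq (NSet 5 (NLit 0) (NLit 0)) (Seq (RSet 4 (NLit 0) (rlit 0)) (Seq (RSet 5 (NLit 0) (rlit 0))
  (While (nlt vi vM)
    (Seq (RSet 4 (NLit 0) (RAdd (rvar 4) (rfrac 3)))
    (Seq (RSet 5 (NLit 0) (RAdd (rvar 5) (rfrac 4)))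
         (NSet 5 (NLit 0) (nsuc vi))))))).

Definition rctr (a : nat) := RSub (rvar a) (RDiv (RNat vM) (RNat vl)).

Definition all_cells : cmd :=
  Seq (NSet 6 (NLit 0) (NLit 0))
  (While (nlt vc vl)
    (Seq fill_overlaps (Seq sum_samples
    (Seq (RSet 6 (NLit 0) (RAdd (rvar 6) (RMul (rvar 7) (RMul (rctr 4) (rctr 5)))))
         (NSet 6 (NLit 0) (nsuc vc)))))).

(** Stops at the first level L with 2^L eps >= 8, so the last level used, J = L - 1, satisfies 4 <=
    2^J eps < 8. Naturals lack multiplication, hence the doubling by addition. *)
Definition all_levels : cmd :=
  Seq (NSet 7 (NLit 0) vk) (Seq (RSet 7 (NLit 0) (rlit 1))
  (While (BNot (BRle (RMul (rlit 8) (RNat vk)) (RMul (RNat vl) veps)))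
    (Seq all_cells
    (Seq (NSet 7 (NLit 0) (NAdd vl vl))
         (RSet 7 (NLit 0) (RMul (rvar 7) (RDiv (rlit 5) (rlit 4)))))))).

Definition decide : cmd :=
  If (BRle (rvar 6) (RMul rM2 (RDiv reps2 (RMul (rlit 320) (RNat vk)))))
     (NSet 1 (NLit 0) (NLit 1)) Skip.

(** No two distributions are more than 2 apart, so YES is correct for eps > 2; it must be given
    without sampling, as the allowed sample size falls below 1 for large eps. *)
Definition tester : cmd :=
  If (BRle veps (rlit 2))
     (Seq draw_first (Seq draw_second (Seq all_levels decide)))
     (NSet 1 (NLit 0) (NLit 1)).

(** * Execution of the tester on fixed samples *)

Section Correctness.
Variables (R : realType) (n k : nat) (eps : R) (p : dist R n).
Variables (sample : nat -> nat) (coin : nat -> bool).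
Variables (M L : nat) (x0 : 'I_n) (xs ys : seq 'I_n).
Hypotheses (k_gt0 : (0 < k)%N) (sxs : size xs = M) (sys : size ys = M).
Hypothesis sample_x : forall i, (i < M)%N -> sample i = nth x0 xs i.
Hypothesis sample_y : forall i, (i < M)%N -> sample (M + i) = nth x0 ys i.

Notation execs := (execs sample coin).

Record frame (st : state R) : Prop := Frame {
  frame_n : nmem st 0 0 = n;
  frame_k : nmem st 0 1 = k;
  frame_eps : rmem st 0 0 = eps;
  frame_p : forall x : 'I_n, rmem st 1 x = p x;
  frame_out : nmem st 1 0 = 0%N;
  frame_M : nmem st 2 0 = M;
  frame_x : forall i, (i < M)%N -> nmem st 3 i = nth x0 xs i;
  frame_y : forall i, (i < M)%N -> nmem st 4 i = nth x0 ys i;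
  frame_drawn : drawn st = (M + M)%N }.

(** The last field is the overlap at t = 0: [fill_overlaps] writes only from index 1 on and relies
    on that initial zero. *)
Record at_cell (l c : nat) (w Z : R) (st : state R) : Prop := AtCell {
  at_cell_frame :> frame st;
  at_cell_l : nmem st 7 0 = l;
  at_cell_c : nmem st 6 0 = c;
  at_cell_w : rmem st 7 0 = w;
  at_cell_Z : rmem st 6 0 = Z;
  at_cell_0 : rmem st 2 0 = 0 }.

Ltac keep_frame H := case: H => -[*] *; split; [split|..]; rewrite /upd //=.

Definition overlap (l c t : nat) : R :=
  Num.min (cdf p t) (c.+1%:R / l%:R) - Num.min (cdf p t) (c%:R / l%:R).

(** The same double difference taken in the other order, so one pass over [n] per cell serves all
    samples. *)
Lemma cell_overlap l c (x : 'I_n) : (overlap l c x.+1 - overlap l c x) / p x = cell p l c x.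
Proof. by rewrite /cell /ucell /overlap; ring. Qed.

Lemma fill_overlaps_ok l c w Z st : (c < l)%N -> at_cell l c w Z st ->
  execs fill_overlaps st (9 * n + 9)
    (fun st' => at_cell l c w Z st' /\ forall t, (t <= n)%N -> rmem st' 2 t = overlap l c t).
Proof.
move=> cl; case: st => nm rm dr fl H.
pose I i (st : state R) := [/\ at_cell l c w Z st, nmem st 5 0 = i, rmem st 3 0 = cdf p i &
   forall t, (t <= i)%N -> rmem st 2 t = overlap l c t].
have ov0 : overlap l c 0 = 0.
  by rewrite /overlap cdf0 !min_l ?subrr // divr_ge0 ?ler0n.
apply: execs_weaken (_ : execs _ _ _ (I n)) _ _; last by move=> st [].
  apply: execs_seq; apply: execs_nset; apply: execs_seq; apply: execs_rset.
  apply: (execs_while (t := 8) (I := I)).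
  - split=> //=; last by move=> t; rewrite leqn0 => /eqP ->; rewrite ov0; case: H.
      by keep_frame H.
    by rewrite cdf0.
  - by move=> i st iN [Hc iE _ _]; rewrite /= iE (frame_n Hc) -ltnNge.
  - by move=> st [Hc iE _ _]; rewrite /= iE (frame_n Hc) leqnn.
  move=> i [nm' rm' dr' fl'] iN [Hc /= i_E acc_E G_E].
  have pi : rm' 1 i = p (Ordinal iN) by have := frame_p Hc (Ordinal iN).
  have cE : nm' 6 0 = c := at_cell_c Hc.
  have lE : nm' 7 0 = l := at_cell_l Hc.
  have accS : rm' 3 0 + rm' 1 i = cdf p i.+1 by rewrite acc_E pi (cdfS p (Ordinal iN)).
  have lo_hi : c%:R / l%:R <= c.+1%:R / l%:R :> R.
    by rewrite ler_wpM2r ?invr_ge0 ?ler0n // ler_nat.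
  apply: execs_weaken (_ : execs _ _ ((1 + (3 + 1).+1).+1) (I i.+1)) _ _ => //.
  apply: execs_seq; apply: execs_rset; rewrite /= i_E accS.
  apply: execs_seq.
  set st1 := State _ _ _ _.
  apply: execs_weaken (_ : execs _ _ 3 (fun st' => st' =
     State nm' (upd (upd rm' 3 0 (cdf p i.+1)) 2 i.+1 (overlap l c i.+1)) dr' fl')) _ _ => //.
    apply: execs_if; rewrite [beval _ _]/= /upd /= cE lE /=.
    case: ifP => h1.
      apply: (execs_le (t := 1)) => //; apply: execs_rset => /=.
      rewrite /upd /= i_E addn1 /overlap !min_l ?subrr //; exact: le_trans lo_hi.
    apply: execs_if; rewrite [beval _ _]/= /upd /= cE lE /= addn1.
    have {}h1 : c%:R / l%:R <= cdf p i.+1 by rewrite ltW // ltNge h1.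
    case: ifP => h2.
      apply: execs_rset => //=.
      by rewrite /upd /= i_E !addn1 cE lE /overlap min_l // min_r.
    apply: execs_rset => //=.
    rewrite /upd /= i_E !addn1 cE lE /overlap !min_r //.
    by rewrite ltW // ltNge h2.
  move=> _ ->; apply: execs_nset; rewrite /= i_E addn1.
  split=> //=; first by keep_frame Hc.
  move=> t; rewrite /upd /= leq_eqVlt => /orP[/eqP ->|ti]; first by rewrite eqxx.
  by rewrite (ltn_eqF ti) G_E.
by lia.
Qed.


Lemma sum_samples_ok l c w Z st : at_cell l c w Z st ->
  (forall t, (t <= n)%N -> rmem st 2 t = overlap l c t) ->
  execs sum_samples st (6 * M + 7)
    (fun st' => [/\ at_cell l c w Z st', rmem st' 4 0 = \sum_(x <- xs) cell p l c x &
                 rmem st' 5 0 = \sum_(y <- ys) cell p l c y]).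
Proof.
case: st => nm rm dr fl H G_E.
pose I i (st : state R) := [/\ at_cell l c w Z st, nmem st 5 0 = i,
   forall t, (t <= n)%N -> rmem st 2 t = overlap l c t,
   rmem st 4 0 = \sum_(x <- take i xs) cell p l c x &
   rmem st 5 0 = \sum_(y <- take i ys) cell p l c y].
apply: execs_weaken (_ : execs _ _ _ (I M)) _ _;
  last by move=> st [Hc _ _ -> ->]; rewrite !take_oversize ?sxs ?sys.
  apply: execs_seq; apply: execs_nset; apply: execs_seq; apply: execs_rset.
  apply: execs_seq; apply: execs_rset.
  apply: (execs_while (t := 5) (I := I)).
  - split=> //=; try by rewrite take0 big_nil.
    by keep_frame H.
  - by move=> i st iM [Hc iE _ _ _]; rewrite /= iE (frame_M Hc) -ltnNge.
  - by move=> st [Hc iE _ _ _]; rewrite /= iE (frame_M Hc) leqnn.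
  move=> i [nm' rm' dr' fl'] iM [Hc /= i_E {}G_E A_E B_E].
  have xE : nm' 3 i = nth x0 xs i := frame_x Hc iM.
  have yE : nm' 4 i = nth x0 ys i := frame_y Hc iM.
  apply: (execs_le (t := (1 + (1 + 1).+1).+1)) => //.
  apply: execs_seq; apply: execs_rset; apply: execs_seq; apply: execs_rset.
  apply: execs_nset; rewrite /upd /= i_E xE yE !addn1.
  have pE (x : 'I_n) : rm' 1 x = p x := frame_p Hc x.
  rewrite !pE !G_E ?ltn_ord ?(ltnW (ltn_ord _)) // !cell_overlap A_E B_E.
  split=> //=; first by keep_frame Hc.
  - by rewrite (take_nth x0) ?sxs // -cats1 big_cat big_seq1.
  - by rewrite (take_nth x0) ?sys // -cats1 big_cat big_seq1.
by lia.
Qed.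

Definition cell_stat (l c : nat) : R :=
  (\sum_(x <- xs) ccell p l c x) * (\sum_(y <- ys) ccell p l c y).

Lemma sum_ccell l c (s : seq 'I_n) :
  \sum_(x <- s) ccell p l c x = \sum_(x <- s) cell p l c x - (size s)%:R / l%:R.
Proof.
rewrite sumrB; congr (_ - _).
by rewrite big_const_seq count_predT iter_addr addr0 mulr_natl.
Qed.

Definition cell_time : nat := 9 * n + 6 * M + 22.

Lemma all_cells_ok l c0 w Z st : at_cell l c0 w Z st ->
  execs all_cells st (cell_time * l + 3)
    (fun st' => at_cell l l w (Z + w * \sum_(c < l) cell_stat l c) st').
Proof.
case: st => nm rm dr fl H.
pose I c := at_cell l c w (Z + w * \sum_(c' < c) cell_stat l c').
apply: (execs_le (t := (1 + (l * cell_time.-1.+1).+1).+1)); last by rewrite /cell_time; lia.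
apply: execs_seq; apply: execs_nset.
apply: (execs_while (I := I)).
- rewrite /I big_ord0 mulr0 addr0; keep_frame H.
- by move=> c st cl Hc; rewrite /= (at_cell_c Hc) (at_cell_l Hc) -ltnNge.
- by move=> st Hc; rewrite /= (at_cell_c Hc) (at_cell_l Hc) leqnn.
move=> c st cl Hc.
apply: (execs_le (t := ((9 * n + 9) + ((6 * M + 7) + (1 + 1).+1).+1).+1)); last first.
  by rewrite /cell_time; lia.
apply: execs_seq; apply: execs_weaken (fill_overlaps_ok cl Hc) (leqnn _) _.
move=> {Hc}st [Hc G_E].
apply: execs_seq; apply: execs_weaken (sum_samples_ok Hc G_E) (leqnn _) _.
move=> {Hc G_E st}[nm' rm' dr' fl'] [Hc A_E B_E].
apply: execs_seq; apply: execs_rset; apply: execs_nset; rewrite /upd /=.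
rewrite /= in A_E B_E; rewrite A_E B_E.
have cE : nm' 6 0 = c := at_cell_c Hc.
have lE : nm' 7 0 = l := at_cell_l Hc.
have wE : rm' 7 0 = w := at_cell_w Hc.
have ZE := at_cell_Z Hc; rewrite /= in ZE.
have ME := frame_M Hc; rewrite /= in ME.
rewrite cE lE wE ZE ME addn1 /I big_ord_recr /= {2}/cell_stat !sum_ccell sxs sys.
by keep_frame Hc; ring.
Qed.

Hypothesis L_low : forall j, (j < L)%N -> (k * 2 ^ j)%:R * eps < 8 * k%:R.
Hypothesis L_high : 8 * k%:R <= (k * 2 ^ L)%:R * eps.

(** Moving the sum over cells outside makes each term a product of two batch sums. *)
Lemma stat_levels : stat p k L xs ys =
  \sum_(j < L) weight R j * \sum_(c < k * 2 ^ j) cell_stat (k * 2 ^ j) c.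
Proof.
rewrite /stat /kernel /lkernel.
under eq_bigr do rewrite exchange_big /=.
rewrite exchange_big /=; apply: eq_bigr => j _.
under eq_bigr do rewrite -mulr_sumr.
rewrite -mulr_sumr; congr (_ * _).
under [LHS]eq_bigr => y _ do rewrite exchange_big /=.
rewrite exchange_big /=; apply: eq_bigr => c _.
under eq_bigr do rewrite -mulr_suml.
by rewrite -mulr_sumr.
Qed.

Lemma all_levels_ok c0 l w st : at_cell l c0 w 0 st ->
  execs all_levels st (L * (cell_time * (k * 2 ^ L) + 8) + 5)
    (fun st' => frame st' /\ rmem st' 6 0 = stat p k L xs ys).
Proof.
case: st => nm rm dr fl H.
pose Zlev J := \sum_(j < J) weight R j * \sum_(c < k * 2 ^ j) cell_stat (k * 2 ^ j) c.
(* The cell counter keeps its final value from the previous level, hence the existential. *)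
pose I j st := exists c, at_cell (k * 2 ^ j) c (weight R j) (Zlev j) st.
apply: execs_weaken (_ : execs _ _ _ (I L)) _ _; last
  by move=> st [c Hc]; rewrite stat_levels; split; [exact: at_cell_frame Hc | exact: at_cell_Z Hc].
  apply: execs_seq; apply: execs_nset; apply: execs_seq; apply: execs_rset.
  apply: (execs_while (t := cell_time * (k * 2 ^ L) + 7) (I := I)).
  - exists c0; have kE := frame_k H; rewrite /= in kE.
    rewrite /Zlev big_ord0 /weight expr0 expn0 muln1 /= kE; keep_frame H.
  - move=> j st jL [c Hc].
    by rewrite /= (at_cell_l Hc) (frame_k Hc) (frame_eps Hc) -ltNge L_low.
  - by move=> st [c Hc]; rewrite /= (at_cell_l Hc) (frame_k Hc) (frame_eps Hc) negbK.
  move=> j st jL [c Hc].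
  apply: (execs_le (t := ((cell_time * (k * 2 ^ j) + 3) + (1 + 1).+1).+1)); last first.
    have : (cell_time * (k * 2 ^ j) <= cell_time * (k * 2 ^ L))%N.
      by rewrite !leq_mul2l leq_exp2l // (ltnW jL) !orbT.
    by lia.
  apply: execs_seq; apply: execs_weaken (all_cells_ok Hc) (leqnn _) _.
  move=> {Hc st}[nm' rm' dr' fl'] Hc.
  apply: execs_seq; apply: execs_nset; apply: execs_rset; exists (k * 2 ^ j)%N.
  have lE : nm' 7 0 = (k * 2 ^ j)%N := at_cell_l Hc.
  have wE : rm' 7 0 = weight R j := at_cell_w Hc.
  have -> : Zlev j.+1 = Zlev j + weight R j * \sum_(c < k * 2 ^ j) cell_stat (k * 2 ^ j) c.
    by rewrite /Zlev big_ord_recr.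
  rewrite /upd /= lE wE addnn -mul2n mulnCA -expnS /weight exprSr.
  keep_frame Hc.
by lia.
Qed.

Hypothesis M_low : forall i, (i < M)%N -> i%:R ^+ 2 * eps ^+ 4 < 1000 ^+ 4 * k%:R.
Hypothesis M_high : 1000 ^+ 4 * k%:R <= M%:R ^+ 2 * eps ^+ 4.

Record drawing (i1 i2 : nat) (st : state R) : Prop := Drawing {
  drawing_n : nmem st 0 0 = n;
  drawing_k : nmem st 0 1 = k;
  drawing_eps : rmem st 0 0 = eps;
  drawing_p : forall x : 'I_n, rmem st 1 x = p x;
  drawing_out : nmem st 1 0 = 0%N;
  drawing_M : nmem st 2 0 = i1;
  drawing_i : nmem st 5 0 = i2;
  drawing_Z : rmem st 6 0 = 0;
  drawing_0 : rmem st 2 0 = 0;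
  drawing_x : forall j, (j < i1)%N -> nmem st 3 j = sample j;
  drawing_y : forall j, (j < i2)%N -> nmem st 4 j = sample (i1 + j);
  drawing_drawn : drawn st = (i1 + i2)%N }.

Lemma draw_first_ok st : drawing 0 0 st ->
  execs draw_first st (M * 4).+1 (drawing M 0).
Proof.
move=> H; apply: (execs_while (t := 3) (I := fun i => drawing i 0)) => //.
- move=> i st' iM D; rewrite /= (drawing_M D) (drawing_k D) (drawing_eps D) -ltNge.
  by move: (M_low iM); rewrite !exprS expr0 !mulr1 !mulrA.
- move=> st' D; rewrite /= (drawing_M D) (drawing_k D) (drawing_eps D) negbK.
  by move: M_high; rewrite !exprS expr0 !mulr1 !mulrA.
move=> i [nm rm dr fl] iM D.
apply: (execs_le (t := (1 + 1).+1)) => //.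
apply: execs_seq; apply: execs_draw; apply: execs_nset.
have ME : nm 2 0 = i := drawing_M D.
have dE : dr = (i + 0)%N := drawing_drawn D.
rewrite /upd /= ME dE addn0 addn1.
case: D => *; split; rewrite //=; last by rewrite addn0.
move=> j; rewrite ltnS leq_eqVlt => /orP[/eqP ->|ji]; first by rewrite eqxx.
by rewrite (ltn_eqF ji); auto.
Qed.

Lemma draw_second_ok st : drawing M 0 st ->
  execs draw_second st (M * 4).+1 (drawing M M).
Proof.
move=> H; apply: (execs_while (t := 3) (I := fun i => drawing M i)) => //.
- by move=> i st' iM D; rewrite /= (drawing_M D) (drawing_i D) -ltnNge.
- by move=> st' D; rewrite /= (drawing_M D) (drawing_i D) leqnn.
move=> i [nm rm dr fl] iM D.
apply: (execs_le (t := (1 + 1).+1)) => //.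
apply: execs_seq; apply: execs_draw; apply: execs_nset.
have iE : nm 5 0 = i := drawing_i D.
have dE : dr = (M + i)%N := drawing_drawn D.
rewrite /upd /= iE dE addn1.
case: D => *; split; rewrite //=; last by rewrite addnS.
move=> j; rewrite ltnS leq_eqVlt => /orP[/eqP ->|ji]; first by rewrite eqxx.
by rewrite (ltn_eqF ji); auto.
Qed.

Definition test_time : nat := M * 8 + L * (cell_time * (k * 2 ^ L) + 8) + 20.

Lemma tester_ok : eps <= 2 ->
  execs tester (init_state k eps p) test_time
    (fun st => drawn st = (M + M)%N /\
       (nmem st 1 0 != 0%N) = (stat p k L xs ys <= threshold k M eps)).
Proof.
move=> e2.
apply: (execs_le (t := ((M * 4).+1 + ((M * 4).+1 +
   ((L * (cell_time * (k * 2 ^ L) + 8) + 5) + 2).+1).+1).+1.+1)); last first.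
  by rewrite /test_time; lia.
apply: execs_if; rewrite [beval _ _]/= e2.
have D0 : drawing 0 0 (init_state k eps p).
  by split; rewrite //= => x; rewrite valK.
apply: execs_seq; apply: execs_weaken (draw_first_ok D0) (leqnn _) _ => st D1.
apply: execs_seq; apply: execs_weaken (draw_second_ok D1) (leqnn _) _ => st2 D2.
have C : at_cell (nmem st2 7 0) (nmem st2 6 0) (rmem st2 7 0) 0 st2.
  case: D2 => *; split; [split|..] => //.
    by move=> i iM; rewrite -sample_x //; auto.
  by move=> i iM; rewrite -sample_y //; auto.
apply: execs_seq; apply: execs_weaken (all_levels_ok C) (leqnn _) _.
move=> [nm rm dr fl] [F Zst]; apply: execs_if.
have kE : nm 0 1 = k := frame_k F.
have eE : rm 0 0 = eps := frame_eps F.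
have ME : nm 2 0 = M := frame_M F.
have oE : nm 1 0 = 0%N := frame_out F.
have dE : dr = (M + M)%N := frame_drawn F.
rewrite /= in Zst.
have -> : beval (State nm rm dr fl) (BRle (rvar 6) (RMul rM2 (RDiv reps2 (RMul (rlit 320) (RNat vk)))))
   = (stat p k L xs ys <= threshold k M eps).
  by rewrite /= Zst kE eE ME /threshold !expr2.
case: ifP => _.
  by apply: execs_nset; rewrite /upd /=.
by apply: execs_skip; rewrite /= oE.
Qed.

Lemma tester_trivial_ok : 2 < eps ->
  execs tester (init_state k eps p) 2
    (fun st => drawn st = 0%N /\ nmem st 1 0 != 0%N).
Proof.
move=> e2; apply: execs_if; rewrite [beval _ _]/= leNgt e2.
exact: execs_nset.
Qed.

End Correctness.

(** * Sample size, running time and correctness *)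

Lemma Ak_dist_le2 (R : realType) n k (p q : dist R n) (eps : R) :
  0 < eps -> eps <= Ak_dist k q p -> eps <= 2.
Proof.
move=> e0 /(Ak_dist_ex e0)[P /and3P[partP _ _] /le_trans]; apply.
apply: le_trans (_ : \sum_(B in P) (mass q B + mass p B) <= _); last first.
  by rewrite big_split /= !sum_mass.
have m0 (q' : dist R n) B : 0 <= mass q' B by apply: sumr_ge0 => i _; apply: pmf_ge0.
apply: ler_sum => B _; apply: le_trans (ler_normB _ _) _.
by rewrite !ger0_norm.
Qed.

Section ProgramOutput.
Variables (R : realType) (n k : nat) (eps : R) (p : dist R n).
Variables (prog : cmd) (m t T : nat) (b : seq 'I_n -> bool).
Hypothesis tT : (t <= T)%N.
Hypothesis exec : forall (s : m.-tuple 'I_n) (coin : nat -> bool),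
  execs (nth 0%N (map val s)) coin prog (init_state k eps p) t
    (fun st => drawn st = m /\ (nmem st 1 0 != 0%N) = b s).

Lemma execs_runs_within : runs_within prog k eps p m T.
Proof.
move=> s r; rewrite /run.
by have [st' -> [-> _]] := execs_halt (exec s (nth false r)) tT.
Qed.

(** The answer does not depend on the coins, so the set of accepting coin sequences is everything or
    empty. *)
Lemma execs_prog_yes (s : m.-tuple 'I_n) : prog_yes prog k eps p T s = (b s)%:R.
Proof.
rewrite /prog_yes; have -> : [set r : T.-tuple bool | says_yes (run prog k eps p s r)]
    = [set r | b s].
  apply/setP => r; rewrite !inE /run /says_yes.
  by have [st' -> [_ <-]] := execs_halt (exec s (nth false r)) tT.
have T0 : (2 : R) ^+ T != 0 by rewrite expf_neq0 // pnatr_eq0.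
case: (b s); last by rewrite cardsE card0 mul0r.
by rewrite cardsE card_tuple card_bool natrX divff.
Qed.

End ProgramOutput.

Section Tester.
Variables (R : realType) (n k : nat) (eps : R) (p : dist R n).
Hypotheses (k2 : (2 <= k <= n)%N) (e0 : 0 < eps).

Let k0 : (0 < k)%N. Proof. by case/andP: k2 => /ltnW. Qed.
Let kR : 0 < k%:R :> R. Proof. by rewrite ltr0n. Qed.

Lemma sample_size_ex : exists M : nat,
  1000 ^+ 4 * k%:R <= M%:R ^+ 2 * eps ^+ 4 /\
  forall i, (i < M)%N -> i%:R ^+ 2 * eps ^+ 4 < 1000 ^+ 4 * k%:R.
Proof.
pose P i := 1000 ^+ 4 * k%:R <= i%:R ^+ 2 * eps ^+ 4.
have exP : exists i, P i.
  pose z := 1000 ^+ 4 * k%:R / eps ^+ 4.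
  have z0 : 0 <= z by rewrite divr_ge0 ?mulr_ge0 ?exprn_ge0 ?ler0n // ltW.
  exists (Num.bound z); rewrite /P -ler_pdivrMr ?exprn_gt0 // -/z.
  have zb := archi_boundP z0; apply: le_trans (ltW zb) _.
  have : (1 <= Num.bound z)%N by rewrite -(ltr0n R) (le_lt_trans z0).
  by rewrite expr2 -(ler1n R) => b1; rewrite ler_peMl.
case: (ex_minnP exP) => M PM minM; exists M; split=> // i iM.
by rewrite ltNge; apply/negP => /minM; rewrite leqNgt iM.
Qed.

Lemma level_count_ex : exists L : nat,
  8 * k%:R <= (k * 2 ^ L)%:R * eps /\
  forall j, (j < L)%N -> (k * 2 ^ j)%:R * eps < 8 * k%:R.
Proof.
pose P j := 8 * k%:R <= (k * 2 ^ j)%:R * eps.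
have exP : exists j, P j.
  pose z := 8 / eps; have z0 : 0 <= z by rewrite divr_ge0 // ltW.
  exists (Num.bound z); rewrite /P natrM [8 * _]mulrC -mulrA ler_pM2l //.
  rewrite -ler_pdivrMr // -/z.
  apply: le_trans (ltW (archi_boundP z0)) _.
  by rewrite ler_nat ltnW // ltn_expl.
case: (ex_minnP exP) => L PL minL; exists L; split=> // j jL.
by rewrite ltNge; apply/negP => /minL; rewrite leqNgt jL.
Qed.

(** M - 1 fails the test, so (M - 1) eps^2 < 1000^2 sqrt k; the last sample costs eps^2 <= 4 <= 4
    sqrt k, which explains the 4. *)
Lemma sample_size_le M : eps <= 2 ->
  (forall i, (i < M)%N -> i%:R ^+ 2 * eps ^+ 4 < 1000 ^+ 4 * k%:R) ->
  M%:R <= (1000 ^+ 2 + 4) * (Num.sqrt k%:R / eps ^+ 2).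
Proof.
move=> e2 lowM; have s1 : 1 <= Num.sqrt k%:R :> R.
  by rewrite -[leLHS]sqrtr1 ler_sqrt ?ltr0n // ler1n.
have e2p : 0 < eps ^+ 2 by rewrite exprn_gt0.
have eps4 : eps ^+ 2 <= 4.
  have -> : 4 = 2 ^+ 2 :> R by ring.
  by rewrite ler_sqr ?nnegrE //; apply: ltW.
rewrite mulrA ler_pdivlMr //.
case: M lowM => [_|M lowM].
  rewrite mul0r mulr_ge0 ?sqrtr_ge0 ?addr_ge0 ?exprn_ge0 ?ler0n //.
have {lowM} := lowM M (leqnn _) => lowM.
have : M%:R * eps ^+ 2 <= 1000 ^+ 2 * Num.sqrt k%:R.
  rewrite -ler_sqr ?nnegrE ?mulr_ge0 ?exprn_ge0 ?sqrtr_ge0 ?ler0n ?(ltW e0) //.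
  have -> : (M%:R * eps ^+ 2) ^+ 2 = M%:R ^+ 2 * eps ^+ 4 by ring.
  have -> : (1000 ^+ 2 * Num.sqrt k%:R) ^+ 2 = 1000 ^+ 4 * Num.sqrt k%:R ^+ 2 :> R by ring.
  by rewrite sqr_sqrtr ?ler0n // ltW.
rewrite -natr1; lra.
Qed.

(** With N = n + 1 / eps: O(N) levels, at most O(N^2) cells in each, and time O(N^3) per cell
    because M = O(N^3). *)
Lemma test_time_le M L : eps <= 2 ->
  M%:R <= (1000 ^+ 2 + 4) * (Num.sqrt k%:R / eps ^+ 2) ->
  (forall j, (j < L)%N -> (k * 2 ^ j)%:R * eps < 8 * k%:R) ->
  (test_time n k M L)%:R <=
    (8 * (1000 ^+ 2 + 4) + 256 * (31 + 6 * (1000 ^+ 2 + 4)) + 148) * (n%:R + eps^-1) ^+ 6.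
Proof.
move=> e2; set K := 1000 ^+ 2 + 4; set N := n%:R + eps^-1 => M_le lowL.
have eV0 : 0 < eps^-1 by rewrite invr_gt0.
have n1 : 1 <= n%:R :> R by rewrite ler1n; case/andP: k2; lia.
have nN : n%:R <= N by rewrite lerDl ltW.
have eN : eps^-1 <= N by rewrite lerDr; lra.
have N1 : 1 <= N by apply: le_trans nN.
have N0 : 0 < N by lra.
have K0 : 0 < K by rewrite /K addr_gt0 // exprn_gt0.
have Npow i j : (i <= j)%N -> N ^+ i <= N ^+ j by move=> ij; apply: ler_weXn2l.
have MN : M%:R <= K * N ^+ 3.
  apply: le_trans M_le _; rewrite ler_pM2l // (exprS N 2).
  have kn : Num.sqrt k%:R <= N.
    apply: le_trans (_ : k%:R <= _); last by apply: le_trans nN; rewrite ler_nat; case/andP: k2.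
    rewrite -ler_sqr ?nnegrE ?sqrtr_ge0 ?ler0n // sqr_sqrtr ?ler0n //.
    by rewrite expr2 ler_peMl ?ler0n // ler1n.
  rewrite -exprVn; apply: ler_pM => //; rewrite ?sqrtr_ge0 ?exprn_ge0 ?(ltW eV0) //.
  by apply: lerXn2r; rewrite ?nnegrE ?(ltW eV0) ?(ltW N0).
have pL : (2 ^ L)%:R <= 16 * N.
  case: L lowL => [_|L lowL]; first by rewrite expn0; lra.
  have := lowL L (leqnn _); rewrite natrM [8 * _]mulrC -mulrA ltr_pM2l //.
  rewrite -ltr_pdivlMr // expnS natrM => h.
  apply: le_trans (_ : 2 * (8 / eps) <= _); first by rewrite ler_pM2l // ltW.
  by rewrite mulrA ler_pM // ?(ltW eV0) // -natrM.
have LN : L%:R <= 16 * N by apply: le_trans pL; rewrite ler_nat ltnW // ltn_expl.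
have lN : (k * 2 ^ L)%:R <= 16 * N ^+ 2.
  rewrite natrM expr2 mulrCA; apply: ler_pM => //; rewrite ?ler0n //.
  by apply: le_trans nN; rewrite ler_nat; case/andP: k2.
have cN : (cell_time n M)%:R <= (31 + 6 * K) * N ^+ 3.
  rewrite /cell_time 2!natrD 2!natrM.
  have : N <= N ^+ 3 by rewrite -[leLHS]expr1 Npow.
  have : 1 <= N ^+ 3 by rewrite exprn_ege1.
  move: MN nN; lra.
have A0 : 0 <= (31 + 6 * K) by lra.
have tN : (cell_time n M * (k * 2 ^ L))%:R <= 16 * (31 + 6 * K) * N ^+ 5.
  rewrite natrM; apply: le_trans (ler_pM _ _ cN lN) _; rewrite ?ler0n //.
  by rewrite le_eqVlt; apply/orP; left; apply/eqP; ring.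
have lvN : (L * (cell_time n M * (k * 2 ^ L) + 8))%:R <= 16 * N * (16 * (31 + 6 * K) * N ^+ 5 + 8).
  rewrite natrM natrD; apply: ler_pM => //; rewrite ?addr_ge0 ?ler0n //.
  by rewrite lerD2r.
rewrite /test_time natrD natrD natrM.
have p3 : N ^+ 3 <= N ^+ 6 by apply: Npow.
have p1 : N <= N ^+ 6 by rewrite -[leLHS]expr1 Npow.
have p0 : 1 <= N ^+ 6 by rewrite exprn_ege1.
have Kp3 : K * N ^+ 3 <= K * N ^+ 6 by rewrite ler_pM2l.
move: lvN; rewrite (_ : 16 * N * _ = 256 * (31 + 6 * K) * N ^+ 6 + 128 * N); last by ring.
have -> : (8 * K + 256 * (31 + 6 * K) + 148) * N ^+ 6 =
  8 * (K * N ^+ 6) + 256 * (31 + 6 * K) * N ^+ 6 + 148 * N ^+ 6 by ring.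
move: (256 * _ * _) => z; lra.
Qed.

End Tester.

Lemma tester_spec (R : realType) (n k : nat) (eps : R) (p : dist R n) :
  (2 <= k <= n)%N -> 0 < eps ->
  exists m T : nat,
    [/\ m%:R <= (2 * (1000 ^+ 2 + 4)) * (Num.sqrt k%:R / eps ^+ 2),
        T%:R <= (8 * (1000 ^+ 2 + 4) + 256 * (31 + 6 * (1000 ^+ 2 + 4)) + 148)
                * (n%:R + eps^-1) ^+ 6,
        runs_within tester k eps p m T
      & tests_identity k eps p
          (fun s : m.-tuple 'I_n => prog_yes tester k eps p T s)].
Proof.
move=> k2 e0; have k0 : (0 < k)%N by case/andP: k2 => /ltnW.
have K0 : 0 < (1000 : R) ^+ 2 by rewrite exprn_gt0.
case: (lerP eps 2) => e2; last first.
  have ex (s : 0.-tuple 'I_n) coin :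
      execs (nth 0%N (map val s)) coin tester (init_state k eps p) 2
        (fun st => drawn st = 0%N /\ (nmem st 1 0 != 0%N) = (fun=> true) (s : seq 'I_n)).
    exact: tester_trivial_ok.
  exists 0%N, 2%N; split.
  - by rewrite mulr_ge0 ?divr_ge0 ?sqrtr_ge0 ?exprn_ge0 ?(ltW e0) //; lra.
  - have N1 : 1 <= (n%:R + eps^-1) ^+ 6.
      rewrite exprn_ege1 //; have : 0 < eps^-1 by rewrite invr_gt0.
      have : 1 <= n%:R :> R by rewrite ler1n; case/andP: k2; lia.
      lra.
    apply: le_trans (_ : 2 * 1 <= _); first by rewrite mulr1.
    by apply: ler_pM => //; lra.
  - exact: (execs_runs_within (b := fun=> true) (leqnn 2) ex).
  have yesE s := execs_prog_yes (b := fun=> true) (leqnn 2) ex s.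
  split=> [s|q]; first by rewrite yesE ler01 lexx.
  split=> [_|far]; last by have := Ak_dist_le2 e0 far; rewrite leNgt e2.
  rewrite /expect; under eq_bigr do rewrite yesE.
  by rewrite (Esamp_tuple q 0 (fun=> true%:R)) Esamp_cst /=; lra.
have [M [M_high M_low]] := sample_size_ex k e0.
have [L [L_high L_low]] := level_count_ex k2 e0.
have kR : 0 < k%:R :> R by rewrite ltr0n.
have M_le := sample_size_le k2 e0 e2 M_low.
(* L = 0 would mean eps >= 8; otherwise [Jlo] comes from the stopping condition and [Jhi] from
   minimality. *)
case: L L_high L_low => [|J] L_high L_low.
  by move: L_high; rewrite expn0 muln1 [8 * _]mulrC ler_pM2l // leNgt; lra.
have Jhi : 2 ^+ J * eps <= 8.
  have := L_low J (leqnn _).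
  by rewrite natrM natrX [8 * _]mulrC -mulrA ltr_pM2l // => /ltW.
have Jlo : 4 <= 2 ^+ J * eps.
  move: L_high; rewrite natrM natrX [8 * _]mulrC -mulrA ler_pM2l // exprS; lra.
have n0 : (0 < n)%N by case/andP: k2 => _; apply: leq_trans.
pose b (s : seq 'I_n) := stat p k J.+1 (take M s) (drop M s) <= threshold k M eps.
have ex (s : (M + M).-tuple 'I_n) coin :
    execs (nth 0%N (map val s)) coin tester (init_state k eps p) (test_time n k M J.+1)
      (fun st => drawn st = (M + M)%N /\ (nmem st 1 0 != 0%N) = b s).
  have sz := size_tuple s.
  apply: (@tester_ok R n k eps p _ coin M J.+1 (Ordinal n0)) => //.
  - by rewrite size_takel // sz leq_addr.
  - by rewrite size_drop sz addnK.
  - move=> i iM; rewrite (nth_map (Ordinal n0)) ?nth_take //.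
    by rewrite sz (leq_trans iM) ?leq_addr.
  - move=> i iM; rewrite (nth_map (Ordinal n0)) ?nth_drop //.
    by rewrite sz ltn_add2l.
exists (M + M)%N, (test_time n k M J.+1); split.
- rewrite natrD; move: M_le; lra.
- exact: test_time_le.
- exact: (execs_runs_within (b := b) (leqnn _) ex).
have yesE s := execs_prog_yes (b := b) (leqnn _) ex s.
have splitE (q : dist R n) (f : bool -> R) :
    expect q (fun s : (M + M).-tuple 'I_n => f (b s)) =
    Esamp q M (fun X => Esamp q M (fun Y => f (stat p k J.+1 X Y <= threshold k M eps))).
  rewrite /expect (Esamp_tuple q _ (fun s => f (b s))) Esamp_cat.
  apply: eq_Esamp => X sX; apply: eq_Esamp => Y sY.
  by rewrite /b take_cat drop_cat sX ltnn subnn take0 drop0 cats0.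
have complE (q : dist R n) : Esamp q M (fun X => Esamp q M (fun Y => (stat p k J.+1 X Y <= threshold k M eps)%R%:R))
   = 1 - Esamp q M (fun X => Esamp q M (fun Y => (~~ (stat p k J.+1 X Y <= threshold k M eps)%R)%:R)).
  apply/eqP; rewrite -subr_eq opprK -EsampD; apply/eqP.
  rewrite -[RHS](Esamp_cst q M); apply: eq_Esamp => X _.
  rewrite -EsampD -[RHS](Esamp_cst q M); apply: eq_Esamp => Y _.
  by case: (_ <= _); rewrite ?addr0 ?add0r.
split=> [s|q]; first by rewrite yesE; case: (b s); rewrite ?lexx ?ler01.
have expE : expect q (fun s : (M + M).-tuple 'I_n => prog_yes tester k eps p (test_time n k M J.+1) s)
    = expect q (fun s : (M + M).-tuple 'I_n => (b s)%:R).
  by rewrite /expect; apply: eq_bigr => s _; rewrite yesE.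
have expE' : expect q (fun s : (M + M).-tuple 'I_n => 1 - prog_yes tester k eps p (test_time n k M J.+1) s)
    = expect q (fun s : (M + M).-tuple 'I_n => (~~ b s)%:R).
  rewrite /expect; apply: eq_bigr => s _; rewrite yesE.
  by case: (b s); rewrite ?subrr ?subr0.
split=> [qp|far].
  subst q; rewrite expE (splitE _ (fun c => c%:R)) complE.
  have := reject_null p J k0 e0 M_high; lra.
rewrite expE' (splitE _ (fun c => (~~ c)%:R)).
have := accept_far k0 e0 e2 Jlo Jhi M_high far; rewrite complE; lra.
Qed.

(** * Lower bound *)

(** For s <= 1 / 2, e^s <= 1 / (1 - s) <= 1 + s + 2 s^2; the linear terms of t and -t cancel. *)
Lemma cosh_le (R : realType) (t : R) : `|t| <= 2^-1 ->
  expR t + expR (- t) <= 2 * expR (2 * t ^+ 2).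
Proof.
rewrite ler_norml => /andP[tl th].
have one (s : R) : s <= 2^-1 -> expR s <= 1 + s + 2 * s ^+ 2.
  move=> s2; have s1 : 0 < 1 - s by lra.
  have := expR_ge1Dx (- s); rewrite expRN => h.
  have : expR s <= (1 - s)^-1 by rewrite -[expR s]invrK lef_pV2 ?posrE ?invr_gt0 ?expR_gt0.
  move/le_trans; apply; rewrite -[leLHS]mul1r ler_pdivrMr // -subr_ge0.
  have -> : (1 + s + 2 * s ^+ 2) * (1 - s) - 1 = s ^+ 2 * (1 - 2 * s) by ring.
  by rewrite mulr_ge0 ?sqr_ge0 //; lra.
have h1 := one t th; have : - t <= 2^-1 by lra.
move/one; rewrite sqrrN => h2; have := expR_ge1Dx (2 * t ^+ 2); lra.
Qed.

Section Paninski.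
Variables (R : realType) (n k : nat) (eps : R).
Hypotheses (k2n : (2 <= k <= n)%N) (eps01 : 0 < eps <= 1).

Let h := k./2.
Let h0 : (0 < h)%N. Proof. rewrite /h; lia. Qed.
Let hk : (h.*2 <= k)%N. Proof. rewrite /h; lia. Qed.
Let e0 : 0 < eps. Proof. by case/andP: eps01. Qed.
Let e1 : eps <= 1. Proof. by case/andP: eps01. Qed.
Let hR : 0 < h%:R :> R. Proof. by rewrite ltr0n. Qed.

Definition sgn (b : bool) : R := if b then 1 else -1.

Definition tilt (z : {ffun 'I_h -> bool}) (x : nat) : R :=
  oapp (fun i : 'I_h => sgn (z i)) 0 (insub x./2) * sgn (odd x).

Lemma sum_pairs N (F : nat -> R) (G : 'I_h -> R) : (h.*2 <= N)%N ->
  (forall i : 'I_h, F i.*2 + F i.*2.+1 = G i) ->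
  \sum_(x < N) (x < h.*2)%:R * F x = \sum_i G i.
Proof.
move=> hN FG; rewrite -(eq_bigr _ (fun i _ => FG i)) -(sum_double h F).
rewrite (big_ord_widen_cond N xpredT F hN) [RHS]big_mkcond /=.
by apply: eq_bigr => x _; case: ltnP; rewrite ?mul1r ?mul0r.
Qed.

Let hn : (h.*2 <= n)%N.
Proof. by case/andP: k2n => _; apply: leq_trans. Qed.

Lemma tilt_double z (i : 'I_h) : tilt z i.*2 = - sgn (z i).
Proof. by rewrite /tilt doubleK valK odd_double /= mulrN1. Qed.

Lemma tilt_doubleS z (i : 'I_h) : tilt z i.*2.+1 = sgn (z i).
Proof. by rewrite /tilt /= uphalf_double valK odd_double /= mulr1. Qed.

Lemma tilt_norm z x : (x < h.*2)%N -> `|tilt z x| = 1.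
Proof.
move=> xh; have xh2 : (x./2 < h)%N by lia.
by rewrite /tilt insubT /= normrM /sgn; case: (z _); case: odd; rewrite ?normrN normr1 mulr1.
Qed.

Definition upmf (d : nat -> R) : {ffun 'I_n -> R} :=
  [ffun x : 'I_n => (x < h.*2)%:R * ((1 + eps * d x) / h.*2%:R)].

Let h2R : 0 < h.*2%:R :> R. Proof. by rewrite ltr0n double_gt0. Qed.

(** The factor c covers both [unif] (c = 0, with dummy signs) and [tilted] (c = 1). *)
Lemma upmf_dist z c : `|c| <= 1 ->
  [forall i, 0 <= upmf (fun x => c * tilt z x) i] &&
  (\sum_i upmf (fun x => c * tilt z x) i == 1).
Proof.
move=> c1; apply/andP; split.
  apply/forallP => x; rewrite ffunE; case: ltnP => xh; last by rewrite mul0r.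
  rewrite mul1r divr_ge0 ?ler0n //.
  have : `|eps * (c * tilt z x)| <= 1.
    rewrite normrM normrM tilt_norm // mulr1 mulr_ile1 //.
    by rewrite ger0_norm // ltW.
  rewrite ler_norml; lra.
under eq_bigr do rewrite ffunE.
rewrite (sum_pairs (F := fun x => (1 + eps * (c * tilt z x)) / h.*2%:R)
  (G := fun=> h%:R^-1) hn) => [|i].
  by rewrite sumr_const card_ord -[_ *+ h]mulr_natl divff // gt_eqF.
rewrite tilt_double tilt_doubleS -mul2n natrM.
by field; rewrite gt_eqF.
Qed.

Definition zero_tilt : {ffun 'I_h -> bool} := [ffun=> false].

Lemma norm0_le1 : `|0 : R| <= 1. Proof. by rewrite normr0. Qed.
Lemma norm1_le1 : `|1 : R| <= 1. Proof. by rewrite normr1. Qed.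

Definition unif : dist R n := Dist (upmf_dist zero_tilt norm0_le1).
Definition tilted z : dist R n := Dist (upmf_dist z norm1_le1).

Lemma unifE x : unif x = (x < h.*2)%:R / h.*2%:R.
Proof. by rewrite /= ffunE mul0r mulr0 addr0 mul1r. Qed.

Lemma tiltedE z x : tilted z x = unif x * (1 + eps * tilt z x).
Proof. by rewrite unifE /= ffunE mul1r mulrAC mulrA. Qed.

(** Take the first k - 1 points as singletons and the rest as last block. Since 2h <= k, every
    charged point is alone among charged points in its block, so nothing cancels and the sum is 2h *
    eps / (2h). *)
Lemma tilted_far z : eps <= Ak_dist k (tilted z) unif.
Proof.
have k0 : (0 < k)%N by case/andP: k2n => /ltnW.
have kn : (k <= n)%N by case/andP: k2n.
have gP (x : 'I_n) : (minn x k.-1 < k)%N by rewrite (leq_ltn_trans (geq_minr _ _)) ?ltn_predL.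
pose g x : 'I_k := Ordinal (gP x).
pose B (c : 'I_k) := [set x | g x == c].
have gw c : g (widen_ord kn c) = c.
  by apply: val_inj => /=; apply/minn_idPl; rewrite -ltnS prednK.
have Binj : injective B.
  by move=> c d /setP /(_ (widen_ord kn c)); rewrite !inE gw eqxx => /esym/eqP.
pose P := [set B c | c : 'I_k].
have partP : interval_partition k P.
  apply/and3P; split; last 1 first.
  - apply/forallP => D; apply/implyP => /imsetP[c _ -> {D}].
    apply/forallP => i; apply/implyP; rewrite inE => /eqP gi.
    apply/forallP => l; apply/implyP; rewrite inE => /eqP gl.
    apply/forallP => j; apply/implyP => /andP[ij jl]; rewrite inE; apply/eqP/val_inj => /=.
    move: (congr1 val gi) (congr1 val gl) => /= {}gi {}gl; lia.
  - apply/and3P; split.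
    + apply/eqP/setP => x; rewrite [RHS]inE; apply/bigcupP.
      by exists (B (g x)); [apply: imset_f | rewrite inE].
    + apply/trivIsetP => _ _ /imsetP[c _ ->] /imsetP[d _ ->] cd.
      rewrite -setI_eq0; apply/eqP/setP => x; rewrite !inE.
      by apply: contraNF cd => /andP[/eqP <- /eqP <-].
    + apply/imsetP => -[c _ /setP /(_ (widen_ord kn c))].
      by rewrite !inE gw eqxx.
  - by rewrite card_imset // card_ord.
apply: le_trans (le_bigmax_cond _ _ partP).
rewrite (big_imset _ (in2W Binj)) /=.
rewrite (eq_bigr (fun c : 'I_k => (c < h.*2)%:R * (eps / h.*2%:R))) => [|c _].
  rewrite (sum_pairs (F := fun=> eps / h.*2%:R) (G := fun=> eps / h%:R) hk) => [|i].
    by rewrite sumr_const card_ord -[_ *+ h]mulr_natr divfK ?gt_eqF.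
  by rewrite -mul2n natrM; field; rewrite gt_eqF.
rewrite /mass -sumrB (bigD1 (widen_ord kn c)) ?inE ?gw //= big1 => [|x /andP[+ xc]].
  rewrite addr0 tiltedE unifE /=; case: ltnP => ch; last by rewrite !mul0r subrr normr0.
  have -> : true%:R / h.*2%:R * (1 + eps * tilt z c) - true%:R / h.*2%:R
     = eps / h.*2%:R * tilt z c :> R by rewrite /=; field; rewrite gt_eqF.
  by rewrite normrM tilt_norm // mulr1 mul1r ger0_norm // divr_ge0 // ltW.
rewrite inE => /eqP gx; rewrite tiltedE unifE.
suff -> : (x < h.*2)%N = false by rewrite !mul0r subrr.
apply/negbTE; rewrite -leqNgt; apply: leq_trans hk _; rewrite leqNgt.
apply: contra xc => xk; apply/eqP/val_inj => /=.
by rewrite -(congr1 val gx) /=; apply/esym/minn_idPl; rewrite -ltnS prednK.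
Qed.

(** Change of measure: the product is the likelihood ratio of the sample. *)
Lemma Esamp_tilted z m f :
  Esamp (tilted z) m f = Esamp unif m (fun s => (\prod_(x <- s) (1 + eps * tilt z x)) * f s).
Proof.
elim: m f => [|m IH] f; first by rewrite /= big_nil mul1r.
rewrite /=; apply: eq_bigr => x _; rewrite tiltedE -mulrA; congr (_ * _).
rewrite IH -EsampZ; apply: eq_Esamp => s _.
by rewrite big_cons mulrA.
Qed.

Lemma mean_tilt z : \sum_x unif x * (1 + eps * tilt z x) = 1.
Proof. by rewrite -[RHS](pmf_sum (tilted z)); apply: eq_bigr => x _; rewrite tiltedE. Qed.

Lemma mean_tilt2 z z' : \sum_x unif x * ((1 + eps * tilt z x) * (1 + eps * tilt z' x)) =
  1 + eps ^+ 2 / h%:R * \sum_i sgn (z i) * sgn (z' i).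
Proof.
under eq_bigr do rewrite unifE -mulrA.
rewrite (sum_pairs (F := fun x => h.*2%:R^-1 * ((1 + eps * tilt z x) * (1 + eps * tilt z' x)))
  (G := fun i => h%:R^-1 + eps ^+ 2 / h%:R * (sgn (z i) * sgn (z' i))) hn) => [|i].
  by rewrite big_split /= -mulr_sumr sumr_const card_ord -[_ *+ h]mulr_natl divff ?gt_eqF.
rewrite !tilt_double !tilt_doubleS -mul2n natrM; field; by rewrite gt_eqF.
Qed.

Lemma card_tilts : #|{: {ffun 'I_h -> bool}}| = (2 ^ h)%N.
Proof. by rewrite card_ffun card_bool card_ord. Qed.

(** 1 + x <= e^x turns the m-th power into a product over pairs, so the sum over sign vectors
    factors into h sums e^t + e^(-t). *)
Lemma tilt2_power_le m z : m%:R * eps ^+ 2 / h%:R <= 2^-1 ->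
  \sum_z' (\sum_x unif x * ((1 + eps * tilt z x) * (1 + eps * tilt z' x))) ^+ m
   <= 2 ^+ h * expR (2 * (m%:R * eps ^+ 2) ^+ 2 / h%:R).
Proof.
set t := _ / _ => t2.
have t0 : 0 <= t by rewrite divr_ge0 ?ler0n // mulr_ge0 ?ler0n ?sqr_ge0.
apply: le_trans (_ : \sum_(z' : {ffun 'I_h -> bool}) \prod_i expR (t * (sgn (z i) * sgn (z' i))) <= _).
  apply: ler_sum => z' _; rewrite -expR_sum -mulr_sumr.
  have -> : t = m%:R * (eps ^+ 2 / h%:R) by rewrite /t mulrA.
  rewrite -mulrA expRM_natl; apply: lerXn2r; rewrite ?nnegrE ?expR_ge0 //.
    apply: sumr_ge0 => x _; case: (ltnP x h.*2) => xh; last by rewrite unifE ltnNge xh !mul0r.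
    rewrite mulrA -tiltedE mulr_ge0 ?pmf_ge0 //.
    have : `|eps * tilt z' x| <= 1 by rewrite normrM tilt_norm // mulr1 ger0_norm ?(ltW e0).
    rewrite ler_norml; lra.
  by rewrite mean_tilt2 expR_ge1Dx.
rewrite -(bigA_distr_bigA (fun i b => expR (t * (sgn (z i) * sgn b)))) /=.
apply: le_trans (_ : \prod_(i : 'I_h) (2 * expR (2 * t ^+ 2)) <= _).
  apply: ler_prod => i _; apply/andP; split; first by apply: sumr_ge0 => b _; rewrite expR_ge0.
  have -> : \sum_(b : bool) expR (t * (sgn (z i) * sgn b)) = expR t + expR (- t).
    by rewrite big_bool /sgn; case: (z i); rewrite !(mulr1, mul1r, mulrN1, opprK) // addrC.
  by apply: cosh_le; rewrite ger0_norm.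
rewrite prodr_const card_ord exprMn -expRM_natl ler_pM2l ?exprn_gt0 // ler_expR.
by rewrite le_eqVlt; apply/orP; left; apply/eqP; rewrite /t; field; rewrite gt_eqF.
Qed.

(** W is the averaged likelihood ratio minus 1. Separating [unif] from the mixture forces E W^2 >= 1
    / 9, whereas too few samples give E W^2 <= e^(6/100) - 1, which is smaller. *)
Lemma identity_test_lower m (yes : m.-tuple 'I_n -> R) :
  tests_identity k eps unif yes -> 10^-1 * (Num.sqrt k%:R / eps ^+ 2) <= m%:R.
Proof.
move=> [yes01 test]; rewrite leNgt; apply/negP => small.
have e2 : 0 < eps ^+ 2 by rewrite exprn_gt0.
pose f (s : seq 'I_n) : R := oapp yes 0 (insub s : option (m.-tuple 'I_n)).
have f01 s : 0 <= f s <= 1 by rewrite /f; case: insub => [t|] /=; rewrite ?yes01 ?lexx ?ler01.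
have expE q : expect q yes = Esamp q m f.
  by rewrite -Esamp_tuple; apply: eq_bigr => s _; rewrite /f valK.
have expE' q : expect q (fun s => 1 - yes s) = 1 - Esamp q m f.
  rewrite -[1 in RHS](Esamp_cst q m) -mulN1r -EsampZ -EsampD -Esamp_tuple.
  by apply: eq_bigr => s _; rewrite /f valK mulN1r.
have Ef : 2 / 3 <= Esamp unif m f by rewrite -expE; apply: (test _).1.
have Ez z : Esamp (tilted z) m f <= 1 / 3.
  by have := (test _).2 (tilted_far z); rewrite expE'; lra.
pose W (s : seq 'I_n) := 2 ^- h * (\sum_z \prod_(x <- s) (1 + eps * tilt z x)) - 1.
have h2 : 0 < (2 : R) ^+ h by rewrite exprn_gt0.
have ones : \sum_(z : {ffun 'I_h -> bool}) 1 = (2 : R) ^+ h.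
  by rewrite sumr_const card_tilts natrX.
have EWf : Esamp unif m (fun s => (W s + 1) * f s) <= 1 / 3.
  apply: le_trans (_ : 2 ^- h * \sum_z Esamp (tilted z) m f <= _).
    rewrite (eq_bigr _ (fun z _ => Esamp_tilted z m f)) -Esamp_sum -EsampZ.
    by apply: ler_Esamp => s _; rewrite /W subrK -mulrA mulr_suml.
  apply: le_trans (_ : 2 ^- h * \sum_(z : {ffun 'I_h -> bool}) 1 / 3 <= _).
    by rewrite ler_pM2l ?invr_gt0 //; apply: ler_sum => z _; apply: Ez.
  by rewrite -mulr_suml ones mulrA mulVf ?gt_eqF.
have EW2 : 9^-1 <= Esamp unif m (fun s => W s ^+ 2).
  (* -W f <= 3/2 W^2 + f^2 / 6, balanced at |W| = 1/3; the gap 1/3 between the acceptance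
     probabilities then leaves 3/2 E W^2 >= 1/6. *)
  have : Esamp unif m f <= Esamp unif m (fun s => (W s + 1) * f s + (3 / 2 * W s ^+ 2 + 6^-1)).
    apply: ler_Esamp => s _; have /andP[fs0 fs1] := f01 s.
    have : f s ^+ 2 <= 1 by rewrite expr_le1.
    have := sqr_ge0 (3 * W s + f s).
    have -> : (3 * W s + f s) ^+ 2 = 6 * (3 / 2 * W s ^+ 2 + W s * f s + f s ^+ 2 / 6) by field.
    have -> : (W s + 1) * f s = W s * f s + f s by ring.
    lra.
  rewrite EsampD EsampD EsampZ Esamp_cst; lra.
have EW2E : Esamp unif m (fun s => W s ^+ 2) = 2 ^- h * (2 ^- h * \sum_z \sum_z'
    (\sum_x unif x * ((1 + eps * tilt z x) * (1 + eps * tilt z' x))) ^+ m) - 1.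
  transitivity (Esamp unif m (fun s => 2 ^- h * (2 ^- h * \sum_z \sum_z' \prod_(x <- s)
      ((1 + eps * tilt z x) * (1 + eps * tilt z' x)))
      + (-2 * 2 ^- h * (\sum_z \prod_(x <- s) (1 + eps * tilt z x)) + 1))).
    apply: eq_Esamp => s _ /=; rewrite /W.
    set a := \sum_z _.
    have -> : \sum_z \sum_z' \prod_(x <- s) ((1 + eps * tilt z x) * (1 + eps * tilt z' x)) = a * a.
      rewrite {1}/a mulr_suml; apply: eq_bigr => z _.
      by rewrite mulr_sumr; apply: eq_bigr => z' _; rewrite big_split.
    by ring.
  rewrite EsampD !EsampZ EsampD EsampZ Esamp_cst !Esamp_sum.
  under [in RHS]eq_bigr do (under eq_bigr do rewrite -Esamp_prod).
  under [X in 2 ^- h * (2 ^- h * X) + _ = _]eq_bigr => z _ do rewrite Esamp_sum.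
  congr (_ + _); under eq_bigr do rewrite Esamp_prod mean_tilt expr1n.
  by rewrite ones -mulrA mulVf ?gt_eqF //; ring.
have kR : 0 < k%:R :> R by rewrite ltr0n; case/andP: k2n => /ltnW.
have k1 : 1 <= k%:R :> R by rewrite ler1n; case/andP: k2n => /ltnW.
(* The worst case is k = 3, h = 1. *)
have hk3 : k%:R <= 3 * h%:R :> R by rewrite -natrM ler_nat /h; case/andP: k2n; lia.
pose u := m%:R * eps ^+ 2.
have u0 : 0 <= u by rewrite mulr_ge0 ?ler0n // ltW.
have uk : u ^+ 2 <= k%:R / 100.
  have lt_u : u <= 10^-1 * Num.sqrt k%:R by move: small; rewrite mulrA ltr_pdivlMr // => /ltW.
  apply: le_trans (_ : (10^-1 * Num.sqrt k%:R) ^+ 2 <= _).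
    by rewrite ler_sqr ?nnegrE // mulr_ge0 ?sqrtr_ge0 // invr_ge0.
  by rewrite exprMn sqr_sqrtr ?ler0n //; lra.
have u_h : u / h%:R <= 2^-1.
  rewrite ler_pdivrMr // -ler_sqr ?nnegrE //; last by rewrite mulr_ge0 ?invr_ge0 // ltW.
  have : h%:R <= h%:R ^+ 2 :> R by rewrite expr2 ler_peMl ?ler0n // ler1n.
  rewrite [X in _ -> _ <= X]exprMn; lra.
have u2h : 2 * u ^+ 2 / h%:R <= 6 / 100 by rewrite ler_pdivrMr //; lra.
have : Esamp unif m (fun s => W s ^+ 2) <= expR (6 / 100) - 1.
  rewrite EW2E lerD2r mulrA -invfM ler_pdivrMl ?mulr_gt0 //.
  rewrite -{1}ones mulr_suml mulr_suml; apply: ler_sum => z _.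
  rewrite mul1r; apply: le_trans (tilt2_power_le z u_h) _.
  by rewrite ler_pM2l // ler_expR.
have : expR (6 / 100) <= (94 / 100)^-1 :> R.
  rewrite -[expR _]invrK lef_pV2 ?posrE ?invr_gt0 ?expR_gt0 // -?expRN; last lra.
  have := expR_ge1Dx (- (6 / 100) : R); lra.
have : (94 / 100)^-1 < 10 / 9 :> R by rewrite invf_div; lra.
move: EW2; lra.
Qed.

End Paninski.

Theorem theorem1 (R : realType) :
  (exists (prog : cmd) (C A : R) (d : nat),
     forall (n k : nat) (eps : R) (p : dist R n),
       (2 <= k <= n)%N -> 0 < eps ->
       exists m T : nat,
         [/\ m%:R <= C * (Num.sqrt k%:R / eps ^+ 2),
             T%:R <= A * (n%:R + eps^-1) ^+ d,
             runs_within prog k eps p m T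
           & tests_identity k eps p
               (fun s : m.-tuple 'I_n => prog_yes prog k eps p T s)]) /\
  (exists2 c : R, 0 < c &
     forall (n k : nat) (eps : R),
       (2 <= k <= n)%N -> 0 < eps <= 1 ->
       forall (m : dist R n -> nat)
              (yes : forall p : dist R n, (m p).-tuple 'I_n -> R),
         (forall p : dist R n, tests_identity k eps p (yes p)) ->
         exists p : dist R n, c * (Num.sqrt k%:R / eps ^+ 2) <= (m p)%:R).
Proof.
split.
  exists tester, (2 * (1000 ^+ 2 + 4)),
    (8 * (1000 ^+ 2 + 4) + 256 * (31 + 6 * (1000 ^+ 2 + 4)) + 148), 6%N.
  by move=> n k eps p; apply: tester_spec.
exists 10^-1 => [|n k eps k2n eps01 m yes test]; first by rewrite invr_gt0.
exists (unif k2n eps01).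
exact: identity_test_lower (test _).
Qed.
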